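(* Let $n\ge1$, let $\sigma\in\mathcal W$ and $\sigma_j=\Delta_j\sigma$, $j=1,\dots,n$. For a polynomial $\rho(t)$ of degree at most $n-1$ in $t$ with coefficients in $\bar U(n)$, define $c_1,\dots,c_n\in\mathrm{Diff}_{\mathbf h,\sigma}(n)$ by $$c(t)=\sum_{i=1}^n\frac{e(t)}{1+\tilde h_it}\,\Gamma_i-\rho(t)=\sum_{k=1}^nc_kt^{k-1},\qquad \Gamma_i:=\bar\partial_ix^i.$$ (i) The elements $c_1,\dots,c_n$ are central in the ring $\mathrm{Diff}_{\mathbf h,\sigma}(n)$ if and only if the polynomial $\rho$ satisfies the system of finite-difference equations $$\Delta_j\rho(t)=\frac{e(t)}{1+\tilde h_jt}\,\sigma_j,\qquad j=1,\dots,n.\qquad( * )$$ (ii) For an arbitrary $\sigma\in\mathcal W$ the system $( * )$ admits a solution. For $\sigma=A(\tilde h_k)/\chi_k\in\mathcal W_k$ with $k\in\{1,\dots,n\}$ and $A$ a univariate polynomial over $\mathbb K$, the solution of $( * )$ is, up to adding a constant from $\mathbb K$ to each coefficient of $\rho(t)$, $$\rho(t)=\frac{e(t)}{1+\tilde h_kt}\,\sigma.$$ (Since $( * )$ is linear in $(\sigma,\rho)$, this determines a solution for every $\sigma\in\mathcal W$.) (iii) Let $\rho$ be a solution of $( * )$. The center of the ring $\mathrm{Diff}_{\mathbf h,\sigma}(n)$ is isomorphic to the polynomial ring $\mathbb K[t_1,\dots,t_n]$; the isomorphism is given by $t_j\mapsto c_j$, $j=1,\dots,n$.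
   Context: $\mathbb K$ is a field of characteristic $0$. $U(n)=\mathbb K[\tilde h_1,\dots,\tilde h_n]$ is the commutative polynomial ring, $\tilde h_{ij}=\tilde h_i-\tilde h_j$, and $\bar U(n)$ is the localization of $U(n)$ with respect to the multiplicative set generated by all $\tilde h_{ij}+a$, $a\in\mathbb Z$, $i\ne j$. For $p\in\bar U(n)$, $p[\pm\varepsilon_j]$ denotes the image of $p$ under the automorphism $\tilde h_i\mapsto\tilde h_i\pm\delta_{ij}$ ($i=1,\dots,n$). $\Delta_j f:=f-f[-\varepsilon_j]$, acting coefficientwise on polynomials in the auxiliary central variable $t$. $e(t)=\prod_{i=1}^n(1+\tilde h_it)$. $\chi_j:=\prod_{k\ne j}\tilde h_{jk}$; $\mathcal W_j$ is the $\mathbb K$-vector space of elements $\pi(\tilde h_j)/\chi_j$ with $\pi$ a univariate polynomial over $\mathbb K$; $\mathcal W:=\sum_{j=1}^n\mathcal W_j$. For $\sigma\in\mathcal W$ and $\sigma_i:=\Delta_i\sigma$, the ring $\mathrm{Diff}_{\mathbf h,\sigma}(n)$ is the ring generated over $\bar U(n)$ by $x^i,\bar\partial_i$, $i=1,\dots,n$, with the defining relations $\tilde h_i x^j=x^j(\tilde h_i+\delta_{ij})$, $\tilde h_i\bar\partial_j=\bar\partial_j(\tilde h_i-\delta_{ij})$ for all $i,j$ (hence $p\,x^j=x^j\,p[\varepsilon_j]$, $p\,\bar\partial_j=\bar\partial_j\,p[-\varepsilon_j]$ for $p\in\bar U(n)$), together with $$x^ix^j=\frac{\tilde h_{ij}+1}{\tilde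 h_{ij}}x^jx^i,\qquad \bar\partial_i\bar\partial_j=\frac{\tilde h_{ij}-1}{\tilde h_{ij}}\bar\partial_j\bar\partial_i\qquad(i<j),$$ $$x^i\bar\partial_j=\bar\partial_jx^i\ \ (i<j),\qquad x^i\bar\partial_j=\frac{\tilde h_{ij}(\tilde h_{ij}-2)}{(\tilde h_{ij}-1)^2}\bar\partial_jx^i\ \ (i>j),$$ $$x^i\bar\partial_i=\sum_{j=1}^n\frac{1}{1-\tilde h_{ij}}\bar\partial_jx^j-\sigma_i,\qquad i=1,\dots,n.$$ *)

(* Defs.v *)
From HB Require Import structures.
From mathcomp Require Import all_boot all_order all_algebra.
From mathcomp Require Import fraction generic_quotient mpoly.
From mathcomp Require Import boolp.

Set Implicit Arguments.
Unset Strict Implicit.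
Unset Printing Implicit Defensive.

Import GRing.Theory.
Local Open Scope ring_scope.
Local Open Scope quotient_scope.

Local Notation "p %:F" := (@FracField.tofrac _ p) : ring_scope.

Section Localization.
Variables (K : fieldType) (n : nat).
Local Notation U := {mpoly K[n]}.

(* The multiplicative set generated by all h_i - h_j + a, a integer, i <> j. *)
Inductive mulset : U -> Prop :=
| mulset_one : mulset 1
| mulset_mul (i j : 'I_n) (a : int) (q : U) :
    i != j -> mulset q -> mulset (('X_i - 'X_j + a%:~R) * q).

Definition in_Ubar : pred {fraction U} :=
  fun x => `[< exists p q : U, mulset q /\ x = p%:F / q%:F >].

(* U(n) is a domain and mulset avoids 0, so the localization is realised as
   a subring of the fraction field of U(n). *)
Record Ubar := MkUbar { Ubar_val : {fraction U}; _ : in_Ubar Ubar_val }.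

HB.instance Definition _ := [isSub for Ubar_val].
HB.instance Definition _ := [Choice of Ubar by <:].

Lemma mulsetM p q : mulset p -> mulset q -> mulset (p * q).
Proof.
elim=> [|i j a r ij _ IH] hq; first by rewrite mul1r.
by rewrite -mulrA; apply: mulset_mul => //; apply: IH.
Qed.

Lemma mulset_gen_neq0 (i j : 'I_n) (a : int) :
  i != j -> 'X_i - 'X_j + a%:~R != 0 :> U.
Proof.
move=> ij; apply/eqP => /(congr1 (mcoeff U_(i)%MM)).
rewrite mcoeffD mcoeffB !mcoeffX eqxx mcoeff0.
have -> : (U_(j)%MM == U_(i)%MM :> 'X_{1..n}) = false.
  apply/negbTE/eqP => /mnmP /(_ i); rewrite !mnm1E eqxx.
  by rewrite eq_sym (negbTE ij).
rewrite -(rmorph_int (@mpolyC n K)) mcoeffC.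
have -> : (U_(i)%MM == 0%MM :> 'X_{1..n}) = false.
  by apply/negbTE/eqP => /mnmP /(_ i); rewrite mnm1E mnm0E eqxx.
by rewrite mulr0 subr0 addr0 => /eqP; rewrite oner_eq0.
Qed.

Lemma mulset_neq0 q : mulset q -> q != 0.
Proof.
elim=> [|i j a r ij _ IH]; first exact: oner_neq0.
by rewrite mulf_neq0 // mulset_gen_neq0.
Qed.

Lemma in_UbarP x :
  reflect (exists p q : U, mulset q /\ x = p%:F / q%:F) (in_Ubar x).
Proof. exact: asboolP. Qed.

Lemma mulsetF q : mulset q -> q%:F != 0.
Proof. by move=> /mulset_neq0; rewrite tofrac_eq0. Qed.

Lemma Ubar_subring : subring_closed in_Ubar.
Proof.
split.
- apply/in_UbarP; exists 1, 1; split; first exact: mulset_one.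
  by rewrite tofrac1 divr1.
- move=> x y /in_UbarP [p [q [hq ->]]] /in_UbarP [r [s [hs ->]]].
  apply/in_UbarP; exists (p * s - r * q), (q * s); split; first exact: mulsetM.
  rewrite tofracB !tofracM -mulNr addf_div ?mulsetF //.
  by rewrite mulNr.
- move=> x y /in_UbarP [p [q [hq ->]]] /in_UbarP [r [s [hs ->]]].
  apply/in_UbarP; exists (p * r), (q * s); split; first exact: mulsetM.
  by rewrite !tofracM mulf_div.
Qed.

HB.instance Definition _ :=
  GRing.SubChoice_isSubComNzRing.Build {fraction U} in_Ubar Ubar Ubar_subring.

Definition Ubar_unit : pred Ubar :=
  fun x => (Ubar_val x != 0) && in_Ubar (Ubar_val x)^-1.
Definition Ubar_inv (x : Ubar) : Ubar :=
  if Ubar_unit x then insubd x (Ubar_val x)^-1 else x.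

Lemma Ubar_mulVx : {in Ubar_unit, left_inverse 1 Ubar_inv *%R}.
Proof.
move=> x ux; have {}ux : Ubar_unit x by [].
rewrite /Ubar_inv ux; case/andP: ux => x0 xV.
by apply: val_inj; rewrite rmorphM rmorph1 /= val_insubd xV mulVf.
Qed.

Lemma Ubar_unitPl x y : y * x = 1 -> Ubar_unit x.
Proof.
move=> /(congr1 val); rewrite rmorphM rmorph1 /= => yx.
have x0 : Ubar_val x != 0.
  by apply/eqP => x0; move/eqP: yx; rewrite x0 mulr0 eq_sym oner_eq0.
rewrite /Ubar_unit x0 /=.
suff -> : (Ubar_val x)^-1 = Ubar_val y by exact: valP.
by apply: (mulIf x0); rewrite mulVf.
Qed.

Lemma Ubar_invx_out : {in [predC Ubar_unit], Ubar_inv =1 id}.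
Proof. by move=> x; rewrite /Ubar_inv; case: ifP => // ux /negP []. Qed.

HB.instance Definition _ :=
  GRing.ComNzRing_hasMulInverse.Build Ubar Ubar_mulVx Ubar_unitPl Ubar_invx_out.

Lemma in_Ubar_tofrac (p : U) : in_Ubar p%:F.
Proof.
apply/in_UbarP; exists p, 1; split; first exact: mulset_one.
by rewrite tofrac1 divr1.
Qed.

Definition toUbar (p : U) : Ubar := MkUbar (in_Ubar_tofrac p).

Lemma toUbar_zmod : zmod_morphism toUbar.
Proof. by move=> p q; apply: val_inj; rewrite rmorphB /= tofracB. Qed.
Lemma toUbar_monoid : monoid_morphism toUbar.
Proof.
split; first by apply: val_inj; rewrite rmorph1 /= tofrac1.
by move=> p q; apply: val_inj; rewrite rmorphM /= tofracM.
Qed.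
HB.instance Definition _ := GRing.isZmodMorphism.Build U Ubar toUbar toUbar_zmod.
HB.instance Definition _ := GRing.isMonoidMorphism.Build U Ubar toUbar toUbar_monoid.

Definition hvar (i : 'I_n) : Ubar := toUbar 'X_i.
Definition hdiff (i j : 'I_n) : Ubar := hvar i - hvar j.
Definition cst (c : K) : Ubar := toUbar c%:MP.

Lemma cst_zmod : zmod_morphism cst.
Proof. by move=> a b; rewrite /cst !rmorphB. Qed.
Lemma cst_monoid : monoid_morphism cst.
Proof. by split=> [|a b]; rewrite /cst ?rmorph1 ?rmorphM. Qed.
HB.instance Definition _ := GRing.isZmodMorphism.Build K Ubar cst cst_zmod.
HB.instance Definition _ := GRing.isMonoidMorphism.Build K Ubar cst cst_monoid.

Lemma mulset_unit q : mulset q -> toUbar q \is a GRing.unit.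
Proof.
move=> hq; apply/andP; split; first exact: mulsetF.
apply/in_UbarP; exists 1, q; split => //.
by rewrite tofrac1 mul1r.
Qed.

Lemma hdiffD_unit (i j : 'I_n) (a : int) :
  i != j -> hdiff i j + a%:~R \is a GRing.unit.
Proof.
move=> ij; have := mulset_unit (mulset_mul a ij mulset_one).
by rewrite mulr1 rmorphD rmorphB rmorph_int.
Qed.

(* The substitution h_i |-> h_i + a delta_ij on U(n). *)
Definition shiftU (j : 'I_n) (a : int) (p : U) : U :=
  p \mPo [tuple 'X_i + (if i == j then a%:~R else 0) | i < n].

Lemma shiftU_zmod j a : zmod_morphism (shiftU j a).
Proof. by move=> p q; rewrite /shiftU raddfB. Qed.
Lemma shiftU_monoid j a : monoid_morphism (shiftU j a).
Proof. by split=> [|p q]; rewrite /shiftU ?rmorph1 ?rmorphM. Qed.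
HB.instance Definition _ j a :=
  GRing.isZmodMorphism.Build U U (shiftU j a) (shiftU_zmod j a).
HB.instance Definition _ j a :=
  GRing.isMonoidMorphism.Build U U (shiftU j a) (shiftU_monoid j a).

Lemma shiftUX j a i :
  shiftU j a 'X_i = 'X_i + (if i == j then a%:~R else 0).
Proof. by rewrite /shiftU comp_mpolyXU -tnth_nth tnth_mktuple. Qed.

Lemma shiftUC j a c : shiftU j a c%:MP = c%:MP.
Proof. exact: comp_mpolyC. Qed.

Lemma mulset_shift j a q : mulset q -> mulset (shiftU j a q).
Proof.
elim=> [|i k b r ik _ IH]; first by rewrite rmorph1; exact: mulset_one.
rewrite rmorphM rmorphD rmorphB rmorph_int /= !shiftUX.
have si (m : 'I_n) : (if m == j then a%:~R else 0 : U)
   = (if m == j then a else 0)%:~R by case: ifP.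
rewrite !si opprD addrACA -intrB -(addrA _ _ b%:~R) -intrD.
exact: mulset_mul.
Qed.

Lemma shiftU_id j a p : shiftU j (- a) (shiftU j a p) = p.
Proof.
rewrite /shiftU; elim/mpolyind: p => [|c m p _ _ IH]; first by rewrite !rmorph0.
rewrite !raddfD /= IH; congr (_ + p).
rewrite !comp_mpolyZ; congr (_ *: _); rewrite comp_mpolyX rmorph_prod /=.
rewrite [RHS]mpolyXE_id; apply: eq_bigr => i _.
rewrite rmorphXn /= tnth_mktuple; congr (_ ^+ _).
have := shiftUX j (- a) i; rewrite /shiftU raddfD /= => ->.
case: ifP => _; last by rewrite raddf0 !addr0.
by rewrite rmorph_int rmorphN /= -addrA addNr addr0.
Qed.

Lemma shiftU_inj j a : injective (shiftU j a).
Proof. exact: can_inj (shiftU_id j a). Qed.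

Lemma toUbar_inj : injective toUbar.
Proof. by move=> p q /(congr1 val) /eqP; rewrite /= tofrac_eq => /eqP. Qed.

Lemma Ubar_fracP (x : Ubar) :
  exists pq : U * U, mulset pq.2 /\ x = toUbar pq.1 / toUbar pq.2.
Proof.
case/in_UbarP: (valP x) => p [q [hq xE]]; exists (p, q); split=> //=.
have uq := mulset_unit hq.
apply: (mulIr uq); rewrite divrK //; apply: val_inj.
by rewrite rmorphM /= [Ubar_val x]xE divfK // mulsetF.
Qed.

Definition Ubar_frac (x : Ubar) : U * U := projT1 (cid (Ubar_fracP x)).

(* p[a eps_j], computed on any presentation of p as a fraction; see shiftE. *)
Definition shift (j : 'I_n) (a : int) (x : Ubar) : Ubar :=
  toUbar (shiftU j a (Ubar_frac x).1) / toUbar (shiftU j a (Ubar_frac x).2).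

Lemma shiftE j a p q : mulset q ->
  shift j a (toUbar p / toUbar q)
  = toUbar (shiftU j a p) / toUbar (shiftU j a q).
Proof.
move=> hq; rewrite /shift /Ubar_frac; case: cid => -[r s] /= [hs E].
have [uq us] := (mulset_unit hq, mulset_unit hs).
have [uq' us'] := (mulset_unit (mulset_shift j a hq),
                   mulset_unit (mulset_shift j a hs)).
have {}E : p * s = r * q.
  apply: toUbar_inj; rewrite !rmorphM /=.
  by rewrite -(divrK uq (toUbar p)) E mulrAC divrK.
apply: (mulIr us'); rewrite divrK // mulrAC; apply: (mulIr uq').
by rewrite divrK // -!rmorphM E.
Qed.

Lemma shift_toUbar j a p : shift j a (toUbar p) = toUbar (shiftU j a p).
Proof.
have := shiftE j a p mulset_one.
by rewrite (rmorph1 (shiftU j a)) rmorph1 !divr1.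
Qed.

Lemma shift_zmod j a : zmod_morphism (shift j a).
Proof.
move=> x y; case: (Ubar_fracP x) => -[p q] /= [hq ->].
case: (Ubar_fracP y) => -[r s] /= [hs ->].
have [uq us] := (mulset_unit hq, mulset_unit hs).
have [uq' us'] := (mulset_unit (mulset_shift j a hq),
                   mulset_unit (mulset_shift j a hs)).
have -> : toUbar p / toUbar q - toUbar r / toUbar s
          = toUbar (p * s - r * q) / toUbar (q * s).
  rewrite rmorphB !rmorphM /= invrM // mulrBl !mulrA; congr (_ - _).
    by rewrite mulrK.
  by rewrite [_ * toUbar q * _]mulrAC mulrK.
rewrite !shiftE //; last exact: mulsetM.
rewrite !rmorphB !rmorphM /= invrM // mulrBl !mulrA; congr (_ - _).
  by rewrite mulrK.
by rewrite [_ * toUbar (shiftU j a q) * _]mulrAC mulrK.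
Qed.

Lemma shift_monoid j a : monoid_morphism (shift j a).
Proof.
split; first by rewrite -(rmorph1 toUbar) shift_toUbar !rmorph1.
move=> x y; case: (Ubar_fracP x) => -[p q] /= [hq ->].
case: (Ubar_fracP y) => -[r s] /= [hs ->].
have [uq us] := (mulset_unit hq, mulset_unit hs).
have [uq' us'] := (mulset_unit (mulset_shift j a hq),
                   mulset_unit (mulset_shift j a hs)).
have -> : toUbar p / toUbar q * (toUbar r / toUbar s)
          = toUbar (p * r) / toUbar (q * s).
  by rewrite !rmorphM /= invrM // [LHS]mulrACA; congr (_ * _); rewrite mulrC.
rewrite !shiftE //; last exact: mulsetM.
by rewrite !rmorphM /= invrM // [RHS]mulrACA; congr (_ * _); rewrite mulrC.
Qed.

HB.instance Definition _ j a :=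
  GRing.isZmodMorphism.Build Ubar Ubar (shift j a) (shift_zmod j a).
HB.instance Definition _ j a :=
  GRing.isMonoidMorphism.Build Ubar Ubar (shift j a) (shift_monoid j a).

Lemma shift_hvar j a i :
  shift j a (hvar i) = hvar i + (if i == j then a%:~R else 0).
Proof.
rewrite shift_toUbar shiftUX rmorphD; congr (_ + _).
by case: ifP => _; rewrite ?rmorph0 ?rmorph_int.
Qed.

Lemma shift_cst j a c : shift j a (cst c) = cst c.
Proof. by rewrite shift_toUbar shiftUC. Qed.

Definition Delta (j : 'I_n) (f : Ubar) : Ubar := f - shift j (-1) f.
Definition Deltat (j : 'I_n) (f : {poly Ubar}) : {poly Ubar} :=
  f - map_poly (shift j (-1)) f.

Definition chi (j : 'I_n) : Ubar := \prod_(k < n | k != j) hdiff j k.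

Lemma chi_unit j : chi j \is a GRing.unit.
Proof.
apply: rpred_prod => k kj; rewrite -[hdiff _ _]addr0.
by apply: (hdiffD_unit 0); rewrite eq_sym.
Qed.

Definition Wfrac (j : 'I_n) (A : {poly K}) : Ubar :=
  (map_poly cst A).[hvar j] / chi j.
Definition inWj (j : 'I_n) (s : Ubar) : Prop := exists A, s = Wfrac j A.
Definition inW (s : Ubar) : Prop :=
  exists w : 'I_n -> Ubar, (forall j, inWj j (w j)) /\ s = \sum_(j < n) w j.

Definition epoly : {poly Ubar} := \prod_(i < n) (1 + hvar i *: 'X).
(* The exact quotient e(t) / (1 + h_i t). *)
Definition equo (i : 'I_n) : {poly Ubar} :=
  \prod_(k < n | k != i) (1 + hvar k *: 'X).

Lemma equoP i : (1 + hvar i *: 'X) * equo i = epoly.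
Proof. by rewrite /epoly (bigD1 i). Qed.

Lemma equo_unique i q : (1 + hvar i *: 'X) * q = epoly -> q = equo i.
Proof.
rewrite -(equoP i) => E; apply/polyP => k.
elim: k => [|k IH].
  have := congr1 (fun r : {poly Ubar} => r`_0) E.
  by rewrite /= !mulrDl !mul1r !coefD -!scalerAl !coefZ !coefXM !mulr0 !addr0.
have := congr1 (fun r : {poly Ubar} => r`_k.+1) E.
by rewrite /= !mulrDl !mul1r !coefD -!scalerAl !coefZ !coefXM /= IH => /addIr.
Qed.

Definition solves (s : Ubar) (rho : {poly Ubar}) : Prop :=
  forall j : 'I_n, Deltat j rho = Delta j s *: equo j.

End Localization.

(* Diff_{h,sigma}(n) is presented by generators and relations: ring terms
   modulo the smallest ring congruence containing the relations. *)
Section Diff.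
Variables (K : fieldType) (n : nat).
Local Notation Ub := (Ubar K n).
Local Notation h := (@hvar K n).
Local Notation hd := (@hdiff K n).

Inductive term : Type :=
| TU of Ub
| TX of 'I_n
| TD of 'I_n
| TOpp of term
| TAdd of term & term
| TMul of term & term.

HB.instance Definition _ := gen_eqMixin term.
HB.instance Definition _ := gen_choiceMixin term.

Variable sigma : Ub.

(* Diff is a K-algebra, so the scalars commute with the generators; together
   with the relations for the h_i this gives p x^j = x^j p[eps_j] and
   p d_j = d_j p[-eps_j] for all p in Ubar. *)
Inductive rel_gen : term -> term -> Prop :=
| rel_cX c j : rel_gen (TMul (TU (cst n c)) (TX j)) (TMul (TX j) (TU (cst n c)))
| rel_cD c j : rel_gen (TMul (TU (cst n c)) (TD j)) (TMul (TD j) (TU (cst n c)))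
| rel_hX i j :
    rel_gen (TMul (TU (h i)) (TX j)) (TMul (TX j) (TU (h i + (i == j)%:R)))
| rel_hD i j :
    rel_gen (TMul (TU (h i)) (TD j)) (TMul (TD j) (TU (h i - (i == j)%:R)))
| rel_XX (i j : 'I_n) : (i < j)%N ->
    rel_gen (TMul (TX i) (TX j))
            (TMul (TU ((hd i j + 1) / hd i j)) (TMul (TX j) (TX i)))
| rel_DD (i j : 'I_n) : (i < j)%N ->
    rel_gen (TMul (TD i) (TD j))
            (TMul (TU ((hd i j - 1) / hd i j)) (TMul (TD j) (TD i)))
| rel_XD_lt (i j : 'I_n) : (i < j)%N ->
    rel_gen (TMul (TX i) (TD j)) (TMul (TD j) (TX i))
| rel_XD_gt (i j : 'I_n) : (j < i)%N ->
    rel_gen (TMul (TX i) (TD j))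
            (TMul (TU (hd i j * (hd i j - 2%:R) / (hd i j - 1) ^+ 2))
                  (TMul (TD j) (TX i)))
| rel_XD_eq i :
    rel_gen (TMul (TX i) (TD i))
            (TAdd (\big[TAdd/TU 0]_(j < n)
                     TMul (TU (1 - hd i j)^-1) (TMul (TD j) (TX j)))
                  (TOpp (TU (Delta i sigma)))).

Inductive cong : term -> term -> Prop :=
| cong_gen a b : rel_gen a b -> cong a b
| cong_refl a : cong a a
| cong_sym a b : cong a b -> cong b a
| cong_trans a b c : cong a b -> cong b c -> cong a c
| cong_opp a b : cong a b -> cong (TOpp a) (TOpp b)
| cong_add a b c d : cong a b -> cong c d -> cong (TAdd a c) (TAdd b d)
| cong_mul a b c d : cong a b -> cong c d -> cong (TMul a c) (TMul b d)
| cong_addA a b c : cong (TAdd a (TAdd b c)) (TAdd (TAdd a b) c)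
| cong_addC a b : cong (TAdd a b) (TAdd b a)
| cong_add0 a : cong (TAdd (TU 0) a) a
| cong_addN a : cong (TAdd (TOpp a) a) (TU 0)
| cong_mulA a b c : cong (TMul a (TMul b c)) (TMul (TMul a b) c)
| cong_mul1 a : cong (TMul (TU 1) a) a
| cong_mulr1 a : cong (TMul a (TU 1)) a
| cong_mulDl a b c : cong (TMul (TAdd a b) c) (TAdd (TMul a c) (TMul b c))
| cong_mulDr a b c : cong (TMul a (TAdd b c)) (TAdd (TMul a b) (TMul a c))
| cong_UD p q : cong (TU (p + q)) (TAdd (TU p) (TU q))
| cong_UM p q : cong (TU (p * q)) (TMul (TU p) (TU q)).

Definition congb : rel term := fun a b => `[< cong a b >].

Lemma congb_refl : reflexive congb.
Proof. by move=> a; apply/asboolP; apply: cong_refl. Qed.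
Lemma congb_sym : ssrbool.symmetric congb.
Proof. by move=> a b; apply/asboolP/asboolP; apply: cong_sym. Qed.
Lemma congb_trans : transitive congb.
Proof.
by move=> b a c /asboolP ab /asboolP bc; apply/asboolP; apply: cong_trans ab bc.
Qed.
Canonical congb_equiv := EquivRel congb congb_refl congb_sym congb_trans.

Definition Diff : Type := {eq_quot congb}.
HB.instance Definition _ : EqQuotient _ congb Diff := EqQuotient.on Diff.
HB.instance Definition _ := Choice.on Diff.

Lemma cong_pi a b : cong a b -> \pi_Diff a = \pi_Diff b.
Proof. by move=> ab; apply/eqmodP/asboolP. Qed.
Lemma pi_cong a b : \pi_Diff a = \pi_Diff b -> cong a b.
Proof. by move=> /eqmodP /asboolP. Qed.
Lemma cong_repr a : cong (repr (\pi_Diff a)) a.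
Proof. by apply: pi_cong; rewrite reprK. Qed.

Definition dzero : Diff := \pi_Diff (TU 0).
Definition done_ : Diff := \pi_Diff (TU 1).
Definition dopp (x : Diff) : Diff := \pi_Diff (TOpp (repr x)).
Definition dadd (x y : Diff) : Diff := \pi_Diff (TAdd (repr x) (repr y)).
Definition dmul (x y : Diff) : Diff := \pi_Diff (TMul (repr x) (repr y)).

Lemma dopp_pi a : dopp (\pi_Diff a) = \pi_Diff (TOpp a).
Proof. by apply/cong_pi/cong_opp/cong_repr. Qed.
Lemma dadd_pi a b : dadd (\pi_Diff a) (\pi_Diff b) = \pi_Diff (TAdd a b).
Proof. by apply/cong_pi/cong_add; apply: cong_repr. Qed.
Lemma dmul_pi a b : dmul (\pi_Diff a) (\pi_Diff b) = \pi_Diff (TMul a b).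
Proof. by apply/cong_pi/cong_mul; apply: cong_repr. Qed.

Lemma daddA : associative dadd.
Proof.
elim/quotW=> a; elim/quotW=> b; elim/quotW=> c.
by rewrite (dadd_pi b c) (dadd_pi a b) !dadd_pi; apply/cong_pi/cong_addA.
Qed.
Lemma daddC : commutative dadd.
Proof.
elim/quotW=> a; elim/quotW=> b; rewrite !dadd_pi; apply: cong_pi; apply: cong_addC.
Qed.
Lemma dadd0 : left_id dzero dadd.
Proof. elim/quotW=> a; rewrite /dzero dadd_pi; apply: cong_pi; apply: cong_add0. Qed.
Lemma daddN : left_inverse dzero dopp dadd.
Proof. elim/quotW=> a; rewrite dopp_pi dadd_pi; apply: cong_pi; apply: cong_addN. Qed.
Lemma dmulA : associative dmul.
Proof.
elim/quotW=> a; elim/quotW=> b; elim/quotW=> c.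
by rewrite (dmul_pi b c) (dmul_pi a b) !dmul_pi; apply/cong_pi/cong_mulA.
Qed.
Lemma dmul1 : left_id done_ dmul.
Proof. elim/quotW=> a; rewrite /done_ dmul_pi; apply: cong_pi; apply: cong_mul1. Qed.
Lemma dmulr1 : right_id done_ dmul.
Proof. elim/quotW=> a; rewrite /done_ dmul_pi; apply: cong_pi; apply: cong_mulr1. Qed.
Lemma dmulDl : left_distributive dmul dadd.
Proof.
elim/quotW=> a; elim/quotW=> b; elim/quotW=> c.
rewrite (dadd_pi a b) (dmul_pi a c) (dmul_pi b c) dmul_pi dadd_pi.
exact/cong_pi/cong_mulDl.
Qed.
Lemma dmulDr : right_distributive dmul dadd.
Proof.
elim/quotW=> a; elim/quotW=> b; elim/quotW=> c.
rewrite (dadd_pi b c) (dmul_pi a b) (dmul_pi a c) dmul_pi dadd_pi.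
exact/cong_pi/cong_mulDr.
Qed.

HB.instance Definition _ := GRing.isZmodule.Build Diff daddA daddC dadd0 daddN.
HB.instance Definition _ :=
  GRing.Zmodule_isPzRing.Build Diff dmulA dmul1 dmulr1 dmulDl dmulDr.

Definition ofUbar (p : Ub) : Diff := \pi_Diff (TU p).
Definition xgen (i : 'I_n) : Diff := \pi_Diff (TX i).
Definition dgen (i : 'I_n) : Diff := \pi_Diff (TD i).
Definition Gamma (i : 'I_n) : Diff := dgen i * xgen i.

Lemma ofUbar_zmod : zmod_morphism ofUbar.
Proof.
move=> p q; apply: (addIr (ofUbar q)); rewrite subrK /ofUbar.
rewrite -[LHS]/(dadd _ _) dadd_pi.
have := cong_pi (cong_UD (p - q) q); rewrite subrK => ->.
by [].
Qed.
Lemma ofUbar_monoid : monoid_morphism ofUbar.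
Proof.
split=> // p q; rewrite -[RHS]/(dmul _ _) dmul_pi.
exact/cong_pi/cong_UM.
Qed.
HB.instance Definition _ := GRing.isZmodMorphism.Build Ub Diff ofUbar ofUbar_zmod.
HB.instance Definition _ := GRing.isMonoidMorphism.Build Ub Diff ofUbar ofUbar_monoid.

Definition central (z : Diff) : Prop := forall y : Diff, z * y = y * z.

(* The coefficient of t^k (k = 0, ..., n-1) in
   c(t) = \sum_i e(t) / (1 + h_i t) Gamma_i - rho(t). *)
Definition ccoef (rho : {poly Ub}) (k : 'I_n) : Diff :=
  \sum_(i < n) ofUbar (equo K i)`_k * Gamma i - ofUbar rho`_k.

End Diff.

(* Main.v *)
(* Diff_{h,sigma}(n) behaves like a generalized Weyl algebra.  Lagrange
   interpolation at t = -1/h_i inverts c(t) = sum_i e(t)/(1 + h_i t) Gamma_i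
   - rho(t), so Gamma_i is an explicit Ubar-combination of the c_k and rho_k,
   and the quotients e(t)/(1 + h_i t) are linearly independent.  The defining
   relations give
     [c(t), x^j] = (e(t)/(1 + h_j t) sigma_j - Delta_j rho(t)) x^j
   and a similar formula for d_j, whence (i) once x^j is known not to be
   annihilated by elements of Ubar.
   When rho solves the system, the ring acts on polynomials in c_1, ..., c_n
   over Ubar: up to a gauge factor x^j acts by the shift h_j -> h_j - 1, and d_j
   by the inverse shift followed by multiplication with the value of Gamma_j; each
   c_k acts by multiplication with the k-th variable.  This gives the
   non-annihilation and the algebraic independence of the c_k.
   A central element commutes with all h_i, hence is a combination of words of
   weight zero (characteristic 0), and such words lie in Ubar[c_1, ..., c_n];
   commutation with the x^j forces the coefficients to be invariant under all
   shifts, and a shift-invariant element of Ubar is a constant. *)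
Require Import Defs.
From HB Require Import structures.
From mathcomp Require Import all_boot all_order all_algebra.
From mathcomp Require Import fraction generic_quotient mpoly.
From mathcomp Require Import ring boolp.

Set Implicit Arguments.
Unset Strict Implicit.
Unset Printing Implicit Defensive.

Import GRing.Theory.
Local Open Scope ring_scope.

(** * Shifts and interpolation in the localized ring *)

Section UbarTheory.
Variables (K : fieldType) (n : nat).
Local Notation Ub := (Ubar K n).
Local Notation h := (@hvar K n).
Local Notation hd := (@hdiff K n).
Implicit Types (i j k l : 'I_n) (a b : int) (p q : Ub).

(** Every element is a quotient of polynomials with invertible denominator, so identities in the
    localization can be checked on scalars and the [h i]. *)
Lemma Ubar_ind (P : Ub -> Prop) :
  (forall c, P (cst n c)) -> (forall i, P (h i)) ->
  (forall p q, P p -> P q -> P (p + q)) ->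
  (forall p q, P p -> P q -> P (p * q)) ->
  (forall p, p \is a GRing.unit -> P p -> P p^-1) ->
  forall p, P p.
Proof.
move=> Pc Ph PD PM PV x.
have PU (p : {mpoly K[n]}) : P (toUbar p).
  elim/mpolyind: p => [|c m p _ _ IH].
    by rewrite -(raddf0 (@mpolyC n K)); apply: (Pc).
  rewrite rmorphD; apply: (PD) => //.
  rewrite -mul_mpolyC rmorphM; apply: (PM); first exact: Pc.
  rewrite mpolyXE_id rmorph_prod; elim/big_rec: _ => [|i y _ Py].
    by rewrite -(rmorph1 (@cst K n)); apply: (Pc).
  apply: (PM) => //; rewrite rmorphXn; elim: (m i) => [|e Pe].
    by rewrite expr0 -(rmorph1 (@cst K n)); apply: (Pc).
  by rewrite exprS; apply: (PM); [exact: (Ph)|exact: Pe].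
have [[p q] /= [hq ->]] := Ubar_fracP x.
by apply: (PM) => //; apply: PV => //; apply: mulset_unit.
Qed.

(** Since [shift] is computed on a chosen fraction, its composition laws are obtained by comparing
    morphisms on generators. *)
Lemma Ubar_rmorph_ext (f g : {rmorphism Ub -> Ub}) :
  (forall c, f (cst n c) = g (cst n c)) -> (forall i, f (h i) = g (h i)) ->
  f =1 g.
Proof.
move=> fgc fgh; apply: Ubar_ind => //.
- by move=> p q fp fq; rewrite !rmorphD fp fq.
- by move=> p q fp fq; rewrite !rmorphM fp fq.
- by move=> p up fp; rewrite !rmorphV // fp.
Qed.

Lemma shiftC i j a b p : shift i a (shift j b p) = shift j b (shift i a p).
Proof.
pose f : {rmorphism Ub -> Ub} := @shift K n i a \o @shift K n j b.
pose g : {rmorphism Ub -> Ub} := @shift K n j b \o @shift K n i a.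
rewrite -[LHS]/(f p) -[RHS]/(g p); apply: Ubar_rmorph_ext => [c|k] /=.
  by rewrite !shift_cst.
rewrite !shift_hvar !rmorphD /= !shift_hvar addrAC.
by do 2!case: ifP => _; rewrite ?rmorph0 ?rmorph_int.
Qed.

Lemma shiftD i a b p : shift i a (shift i b p) = shift i (a + b) p.
Proof.
pose f : {rmorphism Ub -> Ub} := @shift K n i a \o @shift K n i b.
rewrite -[LHS]/(f p); apply: Ubar_rmorph_ext => [c|k] /=.
  by rewrite !shift_cst.
rewrite !shift_hvar rmorphD /= !shift_hvar.
by case: ifP => _; rewrite ?rmorph0 ?rmorph_int -addrA -?rmorphD ?addr0.
Qed.

Lemma shift0 i p : shift i 0 p = p.
Proof.
apply: (Ubar_rmorph_ext (f := @shift K n i 0) (g := idfun)) => [c|k] /=.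
  exact: shift_cst.
by rewrite shift_hvar if_same addr0.
Qed.

Lemma shiftK i p : shift i (-1) (shift i 1 p) = p.
Proof. by rewrite shiftD addNr shift0. Qed.

Lemma shiftNK i p : shift i 1 (shift i (-1) p) = p.
Proof. by rewrite shiftD subrr shift0. Qed.

Lemma shift_hdiff j a i k :
  shift j a (hd i k) =
  hd i k + (if i == j then a%:~R else 0) - (if k == j then a%:~R else 0).
Proof. by rewrite rmorphB /= !shift_hvar opprD addrACA addrA. Qed.

Lemma shift_hdiffl i j a : i != j -> shift i a (hd i j) = hd i j + a%:~R.
Proof. by move=> ij; rewrite shift_hdiff eqxx eq_sym (negbTE ij) subr0. Qed.

Lemma shift_hdiffr i j a : i != j -> shift j a (hd i j) = hd i j - a%:~R.
Proof. by move=> ij; rewrite shift_hdiff eqxx (negbTE ij) addr0. Qed.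

Lemma hdiffC i j : hd i j = - hd j i.
Proof. by rewrite opprB. Qed.

Lemma hdiffii i : hd i i = 0.
Proof. exact: subrr. Qed.

Lemma hdiff_unit i j : i != j -> hd i j \is a GRing.unit.
Proof. by move=> ij; have := hdiffD_unit K 0 ij; rewrite addr0. Qed.

Lemma hdiffD1_unit i j : i != j -> hd i j + 1 \is a GRing.unit.
Proof. exact: (hdiffD_unit K 1). Qed.

Lemma hdiffB1_unit i j : i != j -> hd i j - 1 \is a GRing.unit.
Proof. exact: (hdiffD_unit K (-1)). Qed.

Lemma hdiff1B_unit i j : 1 - hd i j \is a GRing.unit.
Proof.
have [->|ij] := eqVneq i j; first by rewrite hdiffii subr0 unitr1.
by rewrite -opprB unitrN hdiffB1_unit.
Qed.

(* The matrices (lagrange i k) and ((equo j)`_k) are mutually inverse: Lagrange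
   interpolation at t = -1/h_i, homogenised so as not to divide by h_i. *)
Definition lagrange i k : Ub := (-1) ^+ k * h i ^+ (n.-1 - k) / chi K i.

Lemma size_prod_1DZX (R : comNzRingType) (s : seq R) :
  (size (\prod_(x <- s) (1 + x *: 'X) : {poly R})%R <= (size s).+1)%N.
Proof.
elim: s => [|x s IH]; first by rewrite big_nil size_poly1.
rewrite big_cons mulrDl mul1r -scalerAl.
apply: (leq_trans (size_polyD _ _)); rewrite geq_max /= (leqW IH) /=.
apply: (leq_trans (size_scale_leq _ _)).
by apply: (leq_trans (size_polyMleq _ _)); rewrite size_polyX.
Qed.

(** This is a^(size s) times the value of the product at t = b/a, written without dividing by a; it
    serves with a = h_i and b = -1. *)
Lemma homog_prod (R : comNzRingType) (s : seq R) (a b : R) :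
  \sum_(k < (size s).+1)
    a ^+ (size s - k) * b ^+ k * (\prod_(x <- s) (1 + x *: 'X))`_k
  = \prod_(x <- s) (a + b * x).
Proof.
elim: s => [|x s IH].
  by rewrite big_ord1 !big_nil coef1 /= !expr0 !mulr1.
rewrite !big_cons -IH /= [in RHS]mulrDl [in LHS](eq_bigr (fun k : 'I_(size
  s).+2 =>
   a ^+ ((size s).+1 - k) * b ^+ k * (\prod_(y <- s) (1 + y *: 'X))`_k
   + a ^+ ((size s).+1 - k) * b ^+ k
      * (x * ('X * \prod_(y <- s) (1 + y *: 'X))`_k))); last first.
  by move=> k _; rewrite mulrDl mul1r -scalerAl coefD coefZ mulrDr.
rewrite big_split /=; congr (_ + _).
  rewrite big_ord_recr /= mulr_sumr [X in _ + X](_ : _ = 0) ?addr0.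
    by apply: eq_bigr => k _; rewrite subSn ?leq_ord // exprS !mulrA.
  by rewrite nth_default ?mulr0 // size_prod_1DZX.
rewrite big_ord_recl /= coefXM !mulr0 add0r mulr_sumr.
apply: eq_bigr => k _; rewrite coefXM /= /bump /= add1n subSS exprS; ring.
Qed.

Definition others i := [seq k <- index_enum 'I_n | k != i].

Lemma size_others i : (size [seq h k | k <- others i]).+1 = n.
Proof.
have n0 : (0 < n)%N := leq_ltn_trans (leq0n i) (ltn_ord i).
by rewrite size_map -sum1_size big_filter sum1_card cardC1 card_ord prednK.
Qed.

Lemma equoE i : equo K i = \prod_(x <- [seq h k | k <- others i]) (1 + x *: 'X).
Proof. by rewrite big_map big_filter. Qed.

Lemma size_equo i : (size (equo K i) <= n)%N.
Proof. by rewrite equoE -[X in (_ <= X)%N](size_others i) size_prod_1DZX. Qed.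

(** Homogenised at t = -1/h_i, [equo K j] becomes the product of the [hd i k] over k <> j. This is
    chi_i when i = j; otherwise it contains the factor [hd i i] = 0. *)
Lemma lagrangeK i j : \sum_(k < n) lagrange i k * (equo K j)`_k = (i == j)%:R.
Proof.
have E : \sum_(k < n) h i ^+ (n.-1 - k) * (-1) ^+ k * (equo K j)`_k =
   \prod_(k < n | k != j) hd i k.
  rewrite [RHS](eq_bigr (fun k => h i + (-1) * h k)); last first.
    by move=> k _; rewrite mulN1r.
  rewrite -big_filter -(big_map h predT (fun x => h i + -1 * x)) -homog_prod.
  rewrite -equoE.
  have -> : n.-1 = size [seq h k | k <- others j]
    by rewrite -[in LHS](size_others j).
  pose F m := h i ^+ (size [seq h k | k <- others j] - m) * (-1) ^+ m * (equo K
    j)`_m.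
  (* Natural-number indices reconcile the two ranges, whose lengths are equal only through
     [size_others]. *)
  by rewrite -[LHS](big_mkord predT F) -[RHS](big_mkord predT F) size_others.
rewrite (eq_bigr (fun k : 'I_n =>
  (h i ^+ (n.-1 - k) * (-1) ^+ k * (equo K j)`_k) * (chi K i)^-1)); last first.
  by move=> k _; rewrite /lagrange [(-1) ^+ k * _]mulrC mulrAC.
rewrite -mulr_suml E; case: eqVneq => [->|ij]; first by rewrite divrr ?chi_unit.
by rewrite (bigD1 i) //= hdiffii mul0r mul0r.
Qed.

(** Over a commutative ring a left inverse of a square matrix is also a right inverse. *)
Lemma equoK k l : \sum_(i < n) (equo K i)`_k * lagrange i l = (k == l)%:R.
Proof.
pose M := \matrix_(k < n, i < n) (equo K i)`_k.
pose N := \matrix_(i < n, k < n) lagrange i k.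
have NM : N *m M = 1%:M.
  apply/matrixP => i j; rewrite !mxE -lagrangeK.
  by apply: eq_bigr => m _; rewrite !mxE.
have /matrixP/(_ k l) := mulmx1C NM; rewrite !mxE => <-.
by apply: eq_bigr => m _; rewrite !mxE.
Qed.

Lemma shift_equo_id j a : map_poly (shift j a) (equo K j) = equo K j.
Proof.
rewrite rmorph_prod; apply: eq_bigr => k kj.
rewrite rmorphD rmorph1 /= -mul_polyC rmorphM /= map_polyX map_polyC /=.
by rewrite shift_hvar (negbTE kj) addr0 mul_polyC.
Qed.

(** Let q be the product of the factors of e(t) of index other than i and j. The shift adds a t q to
    [equo K i], and [equo K i - equo K j] is - h_ij t q. *)
Lemma shift_equo i j a : i != j ->
  map_poly (shift j a) (equo K i) =
  equo K i - (a%:~R / hd i j) *: (equo K i - equo K j).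
Proof.
move=> ij; have ji: j != i by rewrite eq_sym.
pose q := \prod_(k < n | (k != i) && (k != j)) (1 + h k *: 'X : {poly Ub}).
have Ei : equo K i = (1 + h j *: 'X) * q by rewrite /equo (bigD1 j).
have Ej : equo K j = (1 + h i *: 'X) * q.
  by rewrite /equo (bigD1 i) //; congr (_ * _); apply: eq_bigl => k;
    rewrite andbC.
have qj : map_poly (shift j a) q = q.
  rewrite rmorph_prod; apply: eq_bigr => k /andP [_ kj].
  rewrite rmorphD rmorph1 /= -mul_polyC rmorphM /= map_polyX map_polyC /=.
  by rewrite shift_hvar (negbTE kj) addr0 mul_polyC.
rewrite {1}Ei rmorphM /= qj rmorphD rmorph1 /= -mul_polyC rmorphM /= map_polyX.
rewrite map_polyC /= shift_hvar eqxx mul_polyC.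
have -> : equo K i - equo K j = - hd i j *: ('X * q).
  rewrite Ei Ej -mulrBl opprD addrACA subrr add0r -scalerBl -scalerAl.
  by rewrite opprB.
rewrite scalerA mulrN divrK ?hdiff_unit // scaleNr opprK Ei.
by rewrite scalerDl addrA mulrDl -scalerAl.
Qed.

Lemma shift_equo_coef i j a m : i != j ->
  shift j a (equo K i)`_m =
  (equo K i)`_m - a%:~R / hd i j * ((equo K i)`_m - (equo K j)`_m).
Proof.
move=> ij; have := congr1 (fun p : {poly Ub} => p`_m) (shift_equo a ij).
by rewrite /= coef_map coefB coefZ coefB.
Qed.

Lemma shift_equo_id_coef j a m : shift j a (equo K j)`_m = (equo K j)`_m.
Proof. by rewrite -coef_map shift_equo_id. Qed.

End UbarTheory.

(** * Shift-invariant elements are constants *)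

Section Nonvanishing.
Variable (K : fieldType).
Hypothesis (hK : [pchar K] =i pred0).

Let natK (m : nat) : (m%:R == 0 :> K) = (m == 0)%N.
Proof. exact: (pcharf0P _).1. Qed.

(** In characteristic zero the integers below [size p] are distinct in K, and there is one more of
    them than p can have roots. *)
Lemma poly_nat_neq0 (p : {poly K}) : p != 0 -> exists m : nat, p.[m%:R] != 0.
Proof.
move=> p0; pose s : seq K := [seq m%:R | m <- iota 0 (size p)].
have us : uniq s.
  rewrite map_inj_uniq ?iota_uniq // => a b /eqP.
  wlog le_ab : a b / (a <= b)%N.
    move=> W; case: (leqP a b) => [/W//|/ltnW/W{}W ab].
    by apply/esym/W; rewrite eq_sym.
  by rewrite eq_sym -subr_eq0 -natrB // natK subn_eq0 => ?; apply/eqP;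
    rewrite eqn_leq le_ab.
have ns : ~~ all (root p) s.
  by apply/negP => /(max_poly_roots p0)/(_ us); rewrite size_map size_iota ltnn.
by have /allPn [x /mapP [m _ ->] nx] := ns; exists m.
Qed.

(** Guarantees that a nonzero p stays nonzero when read as a univariate polynomial in its last
    variable. *)
Lemma muni_coef n (p : {mpoly K[n.+1]}) (m : 'X_{1..n.+1}) :
  ((muni p)`_(m ord_max))@_[multinom m (widen_ord (leqnSn n) i) | i < n] = p@_m.
Proof.
rewrite muniE coef_sum raddf_sum /= [in RHS](mpolyE p) raddf_sum /=.
apply: eq_bigr => m' _; rewrite coefZ coefXn !mcoeffZ mcoeffX.
have [->|mm'] := eqVneq m' m.
  by rewrite eqxx mulr1 mcoeffZ mcoeffX eqxx.
case: (eqVneq (m ord_max) (m' ord_max)) => [e|_];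
  last by rewrite mulr0 mcoeff0 mulr0.
rewrite mulr1 mcoeffZ mcoeffX; case: eqP => // /mnmP e'.
case/eqP: mm'; apply/mnmP => i.
have [ilt|ige] := ltnP i n.
  have := e' (Ordinal ilt); rewrite !mnmE.
  by have -> : widen_ord (leqnSn n) (Ordinal ilt) = i by apply: val_inj.
have -> // : i = ord_max.
by apply: val_inj => /=; apply/eqP; rewrite eqn_leq ige -ltnS ltn_ord.
Qed.

Lemma meval_muni n (p : {mpoly K[n.+1]}) (v : 'I_n.+1 -> K) :
  p.@[v] = (map_poly (meval (fun i =>
    v (widen_ord (leqnSn n) i))) (muni p)).[v ord_max].
Proof.
rewrite muniE raddf_sum /= horner_sum mevalE; apply: eq_bigr => m _.
rewrite map_polyZ hornerZ map_polyXn hornerXn /= mevalZ mevalX -mulrA.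
rewrite big_ord_recr /=; congr (_ * (_ * _)).
by apply: eq_bigr => i _; rewrite mnmE.
Qed.

(** Read p in its last variable. By induction the other variables can be specialised without killing
    the leading coefficient, and the one-variable case gives the last value. *)
Lemma mpoly_nat_neq0 n (p : {mpoly K[n]}) :
  p != 0 -> exists v : 'I_n -> nat, p.@[fun i => (v i)%:R] != 0.
Proof.
elim: n p => [|n IH] p p0.
  exists (fun=> 0%N); rewrite mevalE; move: p0; apply: contraNN => /eqP E.
  apply/eqP/mpolyP => m; rewrite mcoeff0 -E [in LHS](mpolyE p) raddf_sum /=.
  apply: eq_bigr => m' _; rewrite mcoeffZ mcoeffX big_ord0.
  by rewrite (_ : m' = m) ?eqxx //; apply/mnmP => -[].
have q0 : muni p != 0.
  apply: contraNneq p0 => q0; apply/eqP/mpolyP => m.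
  by rewrite -muni_coef q0 coef0 !mcoeff0.
have /IH [v vP] : lead_coef (muni p) != 0 by rewrite lead_coef_eq0.
pose f := meval (fun i => (v i)%:R : K).
have /poly_nat_neq0 [m mP] : map_poly f (muni p) != 0.
  apply: contraNneq vP => E; apply/eqP.
  by have := congr1 (fun r : {poly K} => r`_(size (muni p)).-1) E;
    rewrite /f coef_map coef0.
pose w (i : 'I_n.+1) := if unlift ord_max i is Some j then v j else m.
exists w; rewrite meval_muni {2}/w unlift_none.
rewrite (_ : map_poly _ _ = map_poly f (muni p)) //.
apply: eq_map_poly => q; apply: meval_eq => i; congr (_%:R).
rewrite /w; suff -> : widen_ord (leqnSn n) i = lift ord_max i by rewrite liftK.
by apply: val_inj; rewrite /= /bump leqNgt ltn_ord.
Qed.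

Variable n : nat.
Local Notation Ub := (Ubar K n).

Lemma shift_nat_inv (j : 'I_n) (u : Ub) m :
  shift j 1 u = u -> shift j m%:Z u = u.
Proof.
move=> E; elim: m => [|m IH]; first exact: shift0.
by rewrite -addn1 PoszD addrC -(shiftD j 1) IH.
Qed.

(* For u = p / q, invariance gives p(v) q(w) = p(w) q(v) for all lattice points
   v, w; fixing w outside the zeros of q makes p a multiple of q. *)
Lemma shift_invariant (u : Ub) :
  (forall j, shift j (-1) u = u) -> exists c, u = cst n c.
Proof.
move=> inv.
have inv1 j (m : nat) : shift j m%:Z u = u.
  by apply: shift_nat_inv; rewrite -{1}(inv j) shiftNK.
have [[p q] /= [hq uE]] := Ubar_fracP u.
(* [sh v s] shifts by v j in each direction j of s. With s running over all indices, its value at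
   the origin is the value of x at v. *)
pose sh (v : 'I_n -> nat) (s : seq 'I_n) (x : {mpoly K[n]}) :=
  foldr (fun j => shiftU j (v j)%:Z) x s.
have shq v s x : mulset x -> mulset (sh v s x).
  by move=> hx; elim: s => //= j s IH; apply: mulset_shift.
have shE v s : u = toUbar (sh v s p) / toUbar (sh v s q).
  elim: s => [//|j s IH].
  by rewrite -[LHS](inv1 j (v j)) IH shiftE //; apply: shq.
have cross v w s : sh v s p * sh w s q = sh w s p * sh v s q.
  have tM (y z : {mpoly K[n]}) : toUbar (y * z) = toUbar y * toUbar z.
    exact: rmorphM.
  apply: toUbar_inj; rewrite (tM (sh v s p)) (tM (sh w s p)).
  have uv := mulset_unit (shq v s q hq); have uw := mulset_unit (shq w s q hq).
  by rewrite -(divrK uv (toUbar (sh v s p))) -shE (shE w s) mulrAC divrK.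
have evsh v s (x : {mpoly K[n]}) : uniq s ->
    (sh v s x).@[fun=> 0] = x.@[fun i => if i \in s then (v i)%:R else 0].
  (* The induction moves the evaluation point one coordinate at a time, so points that are nonzero
     outside s must be allowed. *)
  suff H w : uniq s -> (forall i, i \in s -> w i = 0) ->
      (sh v s x).@[w] = x.@[fun i => if i \in s then (v i)%:R else w i].
    by move=> us; apply: H.
  elim: s w => [|j s IH] w /=; first by move=> _ _; apply: meval_eq.
  case/andP=> js us w0; rewrite /shiftU comp_mpoly_meval.
  rewrite [LHS](@meval_eq _ _ _ (fun i => if i == j then (v i)%:R else w i));
    last first.
    move=> i; rewrite tnth_mktuple mevalD mevalXU; case: eqP => [->|_].
      by rewrite w0 ?mem_head // add0r -[LHS]/(meval _ _) rmorph_int.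
    by rewrite meval0 addr0.
  rewrite IH //; last first.
    move=> i si; case: eqP => [E|_]; first by rewrite -E si in js.
    by apply: w0; rewrite inE si orbT.
  by apply: meval_eq => i; rewrite inE; case: eqP => [->|//];
    rewrite (negbTE js).
have /mpoly_nat_neq0 [v0 q0] := mulset_neq0 hq.
pose s := enum 'I_n; have us : uniq s := enum_uniq _.
have ev v (x : {mpoly K[n]}) : (sh v s x).@[fun=> 0] = x.@[fun i => (v i)%:R].
  by rewrite evsh //; apply: meval_eq => i; rewrite mem_enum.
pose P (v : 'I_n -> nat) (x : {mpoly K[n]}) := x.@[fun i => (v i)%:R].
have {}cross v w : P v p * P w q = P w p * P v q.
  have := congr1 (meval (fun=> 0)) (cross v w s).
  by rewrite !mevalM !ev.
have E : p = (P v0 p / P v0 q) *: q.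
  apply/eqP; rewrite -subr_eq0; apply/negP => /negP/mpoly_nat_neq0 [v].
  rewrite mevalB mevalZ -/(P v p) -/(P v q) -/(P v0 q) in q0 *.
  case/negP; rewrite subr_eq0 mulrAC -cross mulfK //.
exists (P v0 p / P v0 q); rewrite uE {1}E -mul_mpolyC rmorphM mulrK //.
exact: mulset_unit.
Qed.

End Nonvanishing.

(** * The system of difference equations *)

(** Computations with 1/h_ij and 1/(h_ij + 1) reduce to these relations, which replace division in
    polynomial identities. *)
Lemma partial_fraction (R : comUnitRingType) (x : R) :
  x \is a GRing.unit -> x + 1 \is a GRing.unit ->
  [/\ x * x^-1 = 1, x * (x + 1)^-1 = 1 - (x + 1)^-1
    & x^-1 * (x + 1)^-1 = x^-1 - (x + 1)^-1].
Proof.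
move=> ux ux1; split; first exact: mulrV.
  by rewrite -[X in X - _](mulrV ux1); ring.
by apply: (mulrI ux); apply: (mulIr ux1);
  rewrite mulrBr mulrV // -!mulrA mulVr //
  mulr1 mulrBl mulrV // mul1r -mulrA mulVr // mulr1; ring.
Qed.

(** Coefficient form of [solves_Wfrac] for j <> k: x is h_kj, y and z are the inverses of x and x +
    1, e and f are coefficients of [equo K k] and [equo K j], and w is the fraction. *)
Lemma partial_fraction_cancel (R : comUnitRingType) (x y z w e f : R) :
  [/\ x * y = 1, x * z = 1 - z & y * z = y - z] ->
  w * e - w * (x * z) * (e - -1 * y * (e - f)) = (w - w * (x * z)) * f.
Proof. by case=> y1 z1 yz; ring: z1 y1 yz. Qed.

Section System.
Variables (K : fieldType) (n : nat).
Local Notation Ub := (Ubar K n).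
Local Notation h := (@hvar K n).
Local Notation hd := (@hdiff K n).
Implicit Types (i j k l : 'I_n) (a b : int) (p q : Ub).

(** The numerator depends on h_k only, and [hd k j] is the one factor of chi_k involving h_j. *)
Lemma shift_Wfrac j k a A : j != k ->
  shift j a (Wfrac k A) = Wfrac k A * (hd k j / (hd k j - a%:~R)).
Proof.
move=> jk; have kj : k != j by rewrite eq_sym.
have uh := hdiff_unit K kj.
have uha : hd k j - a%:~R \is a GRing.unit.
  by rewrite -rmorphN /=; apply: hdiffD_unit.
pose c := \prod_(l < n | (l != k) && (l != j)) hd k l.
have Ec : chi K k = hd k j * c by rewrite /chi (bigD1 j).
have uc : c \is a GRing.unit.
  by move: (chi_unit K k); rewrite Ec unitrM => /andP[].
have Ec' : shift j a (chi K k) = (hd k j - a%:~R) * c.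
  rewrite Ec rmorphM /= shift_hdiffr //; congr (_ * _).
  rewrite rmorph_prod; apply: eq_bigr => l /andP [_ lj].
  by rewrite /= shift_hdiff (negbTE kj) (negbTE lj) addr0 subr0.
rewrite /Wfrac rmorphM rmorphV ?chi_unit //= Ec' Ec.
have -> : shift j a (map_poly (@cst K n) A).[h k] =
  (map_poly (@cst K n) A).[h k].
  rewrite -horner_map /= shift_hvar (negbTE kj) addr0 -map_poly_comp.
  by congr (_.[_]); apply: eq_map_poly => c' /=; rewrite shift_cst.
by rewrite !invrM // -!mulrA mulKr.
Qed.

(** For j = k the shift fixes [equo K k], and the difference falls on the fraction alone. For j <> k
    both factors move; the [equo K k] terms cancel and a multiple of [equo K j] remains. *)
Lemma solves_Wfrac k A : solves (Wfrac k A) (Wfrac k A *: equo K k).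
Proof.
move=> j; set w := Wfrac k A.
rewrite /Deltat map_polyZ /= /Delta.
have [->|jk] := eqVneq j k.
  by rewrite shift_equo_id scalerBl.
have kj : k != j by rewrite eq_sym.
rewrite shift_equo // -/w shift_Wfrac // -/w.
apply/polyP => m; rewrite !(coefB, coefZ) rmorphN1 opprK.
have := partial_fraction (hdiff_unit K kj) (hdiffD1_unit K kj).
exact: partial_fraction_cancel.
Qed.

Lemma DeltaD j p q : Delta j (p + q) = Delta j p + Delta j q.
Proof. by rewrite /Delta rmorphD opprD addrACA. Qed.

Lemma DeltatD j (p q : {poly Ub}) : Deltat j (p + q) = Deltat j p + Deltat j q.
Proof. by rewrite /Deltat rmorphD opprD addrACA. Qed.

Lemma solves0 : solves (0 : Ub) 0.
Proof. by move=> j; rewrite /Deltat /Delta !rmorph0 !subr0 scale0r. Qed.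

Lemma solvesD (s s' : Ub) rho rho' :
  solves s rho -> solves s' rho' -> solves (s + s') (rho + rho').
Proof. by move=> S S' j; rewrite DeltatD DeltaD scalerDl S S'. Qed.

Lemma solves_sum_Wfrac (A : 'I_n -> {poly K}) :
  solves (\sum_(k < n) Wfrac k (A k)) (\sum_(k < n) Wfrac k (A k) *: equo K k).
Proof.
apply: (big_ind2 (fun s rho => solves s rho)) => [|s r s' r'|k _].
- exact: solves0.
- exact: solvesD.
- exact: solves_Wfrac.
Qed.

Lemma solves_exists (s : Ub) : inW s ->
  exists rho : {poly Ub}, (size rho <= n)%N /\ solves s rho.
Proof.
case=> w [wW ->]; have [A wA] := choice wW.
exists (\sum_(k < n) Wfrac k (A k) *: equo K k); split.
  apply: (leq_trans (size_sum _ _ _)); apply/bigmax_leqP => k _.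
  by apply: (leq_trans (size_scale_leq _ _)); apply: size_equo.
by rewrite (eq_bigr _ (fun k _ => wA k)); apply: solves_sum_Wfrac.
Qed.

Lemma solves_const (kappa : {poly K}) : solves (0 : Ub) (map_poly (@cst K n)
  kappa).
Proof.
move=> j; rewrite /Deltat /Delta rmorph0 subrr scale0r; apply/eqP.
rewrite subr_eq0 -map_poly_comp; apply/eqP/eq_map_poly => c /=.
by rewrite shift_cst.
Qed.

Hypothesis (hK : [pchar K] =i pred0).

Lemma solves0_const (rho : {poly Ub}) : (size rho <= n)%N -> solves 0 rho ->
  exists kappa : {poly K}, (size kappa <= n)%N /\ rho =
    map_poly (@cst K n) kappa.
Proof.
move=> srho S.
have /choice [f fE] m : exists c, rho`_m = cst n c.
  apply: (shift_invariant hK) => j; apply/esym/eqP; rewrite -subr_eq0.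
  have := congr1 (fun r : {poly Ub} => r`_m) (S j).
  by rewrite /Deltat /Delta rmorph0 subrr scale0r coefB coef_map coef0 /= => ->.
exists (\poly_(m < n) f m); split; first exact: size_poly.
apply/polyP => m; rewrite coef_map coef_poly /=; case: ltnP => // mn.
by rewrite rmorph0 nth_default // (leq_trans srho).
Qed.

(** The difference of two solutions solves the homogeneous system, so its coefficients are
    shift-invariant, hence scalars. *)
Lemma solves_unique (s : Ub) (rho rho' : {poly Ub}) :
  (size rho <= n)%N -> (size rho' <= n)%N -> solves s rho' ->
  (solves s rho <-> exists kappa : {poly K}, (size kappa <= n)%N /\
     rho = rho' + map_poly (@cst K n) kappa).
Proof.
move=> srho srho' S'; split=> [S|[kappa [_ ->]]]; last first.
  by rewrite -[s]addr0; apply: solvesD S' (solves_const _).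
have [|j|kappa [sk E]] := @solves0_const (rho - rho').
- by apply: (leq_trans (size_polyD _ _)); rewrite size_polyN geq_max srho.
- have -> : Deltat j (rho - rho') = Deltat j rho - Deltat j rho'.
    by rewrite /Deltat rmorphB; ring.
  by rewrite S S' subrr /Delta rmorph0 subrr scale0r.
- by exists kappa; rewrite -E addrC subrK.
Qed.
End System.

(** * Commutation relations *)

Lemma shiftM (K : fieldType) n j a (p q : Ubar K n) :
  shift j a (p * q) = shift j a p * shift j a q.
Proof. exact: rmorphM. Qed.

Lemma shiftV (K : fieldType) n j a (p : Ubar K n) :
  p \is a GRing.unit -> shift j a p^-1 = (shift j a p)^-1.
Proof. exact: rmorphV. Qed.

Lemma shiftDl (K : fieldType) n j a (p q : Ubar K n) :
  shift j a (p + q) = shift j a p + shift j a q.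
Proof. exact: rmorphD. Qed.

Section DiffTheory.
Local Open Scope quotient_scope.
Variables (K : fieldType) (n : nat) (sigma : Ubar K n).
Local Notation Ub := (Ubar K n).
Local Notation h := (@hvar K n).
Local Notation hd := (@hdiff K n).
Local Notation D := (Diff sigma).
Local Notation "p %:D" :=
  (ofUbar sigma p) (at level 2, left associativity, format "p %:D").
Local Notation x := (xgen sigma).
Local Notation d := (dgen sigma).
Local Notation Gam := (@Gamma K n sigma).
Local Notation e i k := ((equo K i)`_k).
Implicit Types (i j k l : 'I_n) (a b : int) (p q : Ub).

Lemma pi_TMul (s t : term K n) : \pi_D (TMul s t) = \pi_D s * \pi_D t.
Proof. exact/esym/dmul_pi. Qed.
Lemma pi_TAdd (s t : term K n) : \pi_D (TAdd s t) = \pi_D s + \pi_D t.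
Proof. exact/esym/dadd_pi. Qed.
Lemma pi_TOpp (s : term K n) : \pi_D (TOpp s) = - \pi_D s.
Proof. exact/esym/dopp_pi. Qed.

Lemma Diff_ind (P : D -> Prop) :
  (forall p, P p%:D) -> (forall i, P (x i)) -> (forall i, P (d i)) ->
  (forall y, P y -> P (- y)) ->
  (forall y z, P y -> P z -> P (y + z)) ->
  (forall y z, P y -> P z -> P (y * z)) ->
  forall z, P z.
Proof.
move=> PU Px Pd PN PD PM; elim/quotW; elim=> [p|i|i|t|s Ps t Pt|s Ps t Pt].
- exact: PU.
- exact: Px.
- exact: Pd.
- by rewrite pi_TOpp; apply: PN.
- by rewrite pi_TAdd; apply: PD.
- by rewrite pi_TMul; apply: PM.
Qed.

Lemma rel_eq (s t : term K n) : rel_gen sigma s t -> \pi_D s = \pi_D t.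
Proof. by move=> st; apply/cong_pi/cong_gen. Qed.

(** The relations prescribe commutation only with scalars and the [h k]. It extends along
    [Ubar_ind]; for an inverse, p is cancelled against its shifted image on the other side of y. *)
Lemma commute_shift (y : D) i a :
  (forall c, (cst n c)%:D * y = y * (cst n c)%:D) ->
  (forall k, (h k)%:D * y = y * (shift i a (h k))%:D) ->
  forall p, p%:D * y = y * (shift i a p)%:D.
Proof.
move=> yc yh; apply: Ubar_ind => [c|k|p q Ep Eq|p q Ep Eq|p up Ep].
- by rewrite shift_cst.
- exact: yh.
- by rewrite !rmorphD mulrDl mulrDr Ep Eq.
- by rewrite shiftM (rmorphM _ p q) (rmorphM _ (shift i a p)) -mulrA Eq mulrA
  Ep mulrA.
rewrite shiftV //; set q := shift i a p in Ep *.
have uq : q \is a GRing.unit by apply: rmorph_unit.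
rewrite -[LHS]mulr1 -(rmorph1 (ofUbar sigma)) -(mulrV uq) (rmorphM _ q) !mulrA.
by rewrite -[_ * y * _]mulrA -Ep !mulrA -(rmorphM _ _ p) mulVr // rmorph1 mul1r.
Qed.

Lemma ofUbar_x p j : p%:D * x j = x j * (shift j 1 p)%:D.
Proof.
apply: commute_shift => [c|k].
  by have := rel_eq (rel_cX sigma c j); rewrite !pi_TMul.
have := rel_eq (rel_hX sigma k j); rewrite !pi_TMul -!/(ofUbar _ _) shift_hvar.
by case: eqP.
Qed.

Lemma ofUbar_d p j : p%:D * d j = d j * (shift j (-1) p)%:D.
Proof.
apply: commute_shift => [c|k].
  by have := rel_eq (rel_cD sigma c j); rewrite !pi_TMul.
have := rel_eq (rel_hD sigma k j); rewrite !pi_TMul -!/(ofUbar _ _) shift_hvar.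
by case: eqP => _; rewrite ?rmorphN ?subr0 ?addr0.
Qed.

Lemma x_ofUbar p j : x j * p%:D = (shift j (-1) p)%:D * x j.
Proof. by rewrite ofUbar_x shiftNK. Qed.

Lemma d_ofUbar p j : d j * p%:D = (shift j 1 p)%:D * d j.
Proof. by rewrite ofUbar_d shiftK. Qed.

Lemma ofUbar_Gamma p i : p%:D * Gam i = Gam i * p%:D.
Proof. by rewrite /Gamma mulrA ofUbar_d -mulrA ofUbar_x shiftNK mulrA. Qed.

Lemma xx_lt i j : (i < j)%N -> x i * x j =
  ((hd i j + 1) / hd i j)%:D * (x j * x i).
Proof. by move=> /(rel_XX sigma)/rel_eq; rewrite !pi_TMul. Qed.

Lemma dd_lt i j : (i < j)%N -> d i * d j =
  ((hd i j - 1) / hd i j)%:D * (d j * d i).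
Proof. by move=> /(rel_DD sigma)/rel_eq; rewrite !pi_TMul. Qed.

Lemma xd_lt i j : (i < j)%N -> x i * d j = d j * x i.
Proof. by move=> /(rel_XD_lt sigma)/rel_eq; rewrite !pi_TMul. Qed.

Lemma xd_gt i j : (j < i)%N ->
  x i * d j = (hd i j * (hd i j - 2%:R) / (hd i j - 1) ^+ 2)%:D * (d j * x i).
Proof. by move=> /(rel_XD_gt sigma)/rel_eq; rewrite !pi_TMul. Qed.

Lemma xd_eq i :
  x i * d i = \sum_(j < n) ((1 - hd i j)^-1)%:D * Gam j - (Delta i sigma)%:D.
Proof.
have := rel_eq (rel_XD_eq sigma i); rewrite pi_TMul pi_TAdd pi_TOpp => ->.
congr (_ - _); rewrite (big_morph (\pi_D) pi_TAdd (id1 := 0)) //.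
by apply: eq_bigr => j _; rewrite !pi_TMul.
Qed.

Lemma ofUbar_swap (u : Ub) (y z : D) :
  u \is a GRing.unit -> y = u%:D * z -> z = (u^-1)%:D * y.
Proof. by move=> uu ->; rewrite mulrA -rmorphM mulVr // rmorph1 mul1r. Qed.

Lemma hdiffB2_unit i j : i != j -> hd i j - 2%:R \is a GRing.unit.
Proof. exact: (hdiffD_unit K (-2)). Qed.

(** For j < i the defining relation of the pair (j, i) is inverted, using h_ji = - h_ij. *)
Lemma xx_neq i j : i != j ->
  x i * x j = (if (i < j)%N then (hd i j + 1) / hd i j else hd i j / (hd i j -
    1))%:D
              * (x j * x i).
Proof.
move=> ij; case: ltnP => [/xx_lt //|]; rewrite leq_eqVlt eq_sym.
rewrite (inj_eq val_inj) (negbTE ij) /= => /xx_lt /ofUbar_swap -> //.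
  rewrite invrM ?unitrV ?hdiff_unit ?hdiffD1_unit // 1?eq_sym // invrK.
  have E : - hd i j + 1 = - (hd i j - 1) by ring.
  rewrite (hdiffC K j i) E; congr (_%:D * _).
  by rewrite invrN mulrNN.
by rewrite unitrM unitrV ?hdiff_unit ?hdiffD1_unit // 1?eq_sym.
Qed.

Lemma dd_neq i j : i != j ->
  d i * d j = (if (i < j)%N then (hd i j - 1) / hd i j else hd i j / (hd i j +
    1))%:D
              * (d j * d i).
Proof.
move=> ij; have ji : j != i by rewrite eq_sym.
case: ltnP => [/dd_lt //|]; rewrite leq_eqVlt eq_sym.
rewrite (inj_eq val_inj) (negbTE ij) /= => /dd_lt /ofUbar_swap -> //.
  rewrite invrM ?unitrV ?hdiff_unit ?hdiffB1_unit // invrK.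
  rewrite (hdiffC K j i) -opprD; congr (_%:D * _).
  by rewrite invrN mulrNN.
by rewrite unitrM unitrV ?hdiff_unit ?hdiffB1_unit.
Qed.

Lemma xd_neq i j : i != j -> x i * d j =
  (if (i < j)%N then 1 else hd i j * (hd i j - 2%:R) / (hd i j - 1) ^+ 2)%:D
  * (d j * x i).
Proof.
move=> ij; case: ltnP => [/xd_lt ->|]; first by rewrite rmorph1 mul1r.
by rewrite leq_eqVlt eq_sym (inj_eq val_inj) (negbTE ij) /= => /xd_gt.
Qed.

(** Both sides are brought to the form d_i x^j x^i. The relations used differ for i < j and j < i,
    but the coefficients have ratio 1 + 1/h_ij in both cases. *)
Lemma Gamma_x i j : i != j ->
  Gam i * x j = (1 + (hd i j)^-1)%:D * (x j * Gam i).
Proof.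
move=> ij; have ji : j != i by rewrite eq_sym.
have u0 := hdiff_unit K ij; have u1 := hdiffD1_unit K ij.
have u2 : hd i j + 1 + 1 \is a GRing.unit.
  by rewrite -addrA; apply: (hdiffD_unit K 2).
rewrite /Gamma -mulrA xx_neq // mulrA d_ofUbar -!mulrA.
rewrite (mulrA (x j)) (xd_neq ji) -!mulrA (mulrA _ _ (d i * _)) -rmorphM;
  congr (_%:D * _).
case: (ltngtP i j) => [lt_ij|lt_ji|/val_inj E]; last by rewrite E eqxx in ij.
- rewrite shiftM shiftV // (shiftDl _ _ (hd i j)) rmorph1 shift_hdiffl //
  mulr1z.
  rewrite (hdiffC K j i) (_ : (- hd i j - 1) ^+ 2 = (hd i j + 1) ^+ 2);
    last by ring.
  (* A quotient equal to 1 is inserted so that the rest is a polynomial identity in the inverses. *)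
  transitivity (((1 + (hd i j)^-1) * hd i j) / (hd i j + 1) * ((hd i j + 1 + 1)
    / (hd i j + 1))).
    by rewrite [in RHS]mulrDl mul1r mulVr // [in RHS]divrr // mul1r.
  by rewrite -exprVn; ring.
- rewrite shiftM (shiftV _ _ (hdiffB1_unit K ij)) (shiftDl _ _ (hd i j))
  rmorphN1.
  by rewrite shift_hdiffl // rmorph1 addrK mulrDl divrr // mul1r mulr1.
Qed.

Lemma Gamma_d i j : i != j ->
  Gam i * d j = (1 - (hd i j)^-1)%:D * (d j * Gam i).
Proof.
move=> ij; have ji : j != i by rewrite eq_sym.
have u0 := hdiff_unit K ij; have u1 := hdiffB1_unit K ij.
rewrite /Gamma -mulrA (xd_neq ij) !mulrA d_ofUbar -!mulrA (mulrA (d i)) (dd_neq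
  ij).
rewrite -!mulrA (mulrA (_%:D)) -rmorphM; congr (_%:D * _).
case: (ltngtP i j) => [lt_ij|lt_ji|/val_inj E]; last by rewrite E eqxx in ij.
  by rewrite rmorph1 mul1r mulrBl divrr // mul1r.
have E : shift i 1 (hd i j - 1) = hd i j.
  by rewrite (shiftDl _ _ (hd i j)) rmorphN1 shift_hdiffl // mulr1z addrK.
have E2 : shift i 1 (hd i j - 2%:R) = hd i j - 1.
  rewrite (shiftDl _ _ (hd i j)) rmorphN rmorph_nat shift_hdiffl // mulr1z;
    ring.
rewrite !shiftM shiftV ?unitrX // rmorphXn /= E E2 shift_hdiffl // mulr1z.
transitivity ((hd i j + 1) / (hd i j + 1) * ((hd i j - 1) / hd i j) * (hd i j /
  hd i j)).
  by rewrite -exprVn; ring.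
by rewrite !divrr ?hdiffD1_unit // mul1r mulr1 mulrBl divrr // mul1r.
Qed.

(** Expand (x^j d_j) x^j by the diagonal relation: its j-th term is Gamma_j x^j, and in the others
    Gamma_i moves past x^j, with (1 + 1/h_ij) / (h_ij + 1) = 1/h_ij. *)
Lemma Gamma_x_diag j :
  Gam j * x j = x j * Gam j + (Delta j sigma)%:D * x j
    - \sum_(i < n | i != j) (hd i j)^-1%:D * (x j * Gam i).
Proof.
rewrite {2}/Gamma mulrA xd_eq mulrBl mulr_suml (bigD1 j) //= hdiffii subr0
  invr1.
rewrite rmorph1 mul1r subrK -addrA [X in _ + X](_ : _ = 0) ?addr0 //.
apply/eqP; rewrite subr_eq0; apply/eqP/eq_bigr => i ij.
rewrite -mulrA Gamma_x // (mulrA _ _ (x j * _)) -rmorphM; congr (_%:D * _).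
have [y1 z1 yz] := partial_fraction (hdiff_unit K ij) (hdiffD1_unit K ij).
have -> : 1 - hd j i = hd i j + 1 by rewrite (hdiffC K j i) opprK addrC.
by rewrite mulrDr mulr1 mulrC yz addrC subrK.
Qed.

(** The same relation, applied inside d_j (x^j d_j). *)
Lemma Gamma_d_diag j :
  Gam j * d j = d j * Gam j - d j * (Delta j sigma)%:D
    + \sum_(i < n | i != j) (hd i j)^-1%:D * (d j * Gam i).
Proof.
rewrite {1}/Gamma -mulrA xd_eq mulrBr mulr_sumr (bigD1 j) //= hdiffii subr0
  invr1.
rewrite rmorph1 mul1r addrAC; congr (_ + _); apply: eq_bigr => i ij.
rewrite (mulrA (d j) (ofUbar _ _)) d_ofUbar -(mulrA _ (d j)); congr (_%:D * _).
have ji : j != i by rewrite eq_sym.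
rewrite shiftV ?hdiff1B_unit //; congr (_^-1).
by rewrite (shiftDl _ _ 1) rmorph1 rmorphN /= shift_hdiffl // (hdiffC K j i)
  mulr1z; ring.
Qed.

(** The off-diagonal terms of [Gamma_x_diag] are exactly those produced by [shift_equo_coef] when
    the coefficients move past x^j, so only the sigma term survives. *)
Lemma sum_Gamma_x j m :
  (\sum_(i < n) (e i m)%:D * Gam i) * x j =
  x j * (\sum_(i < n) (e i m)%:D * Gam i) + (e j m * Delta j sigma)%:D * x j.
Proof.
rewrite mulr_suml mulr_sumr.
rewrite [in RHS](eq_bigr (fun i =>
  (shift j (-1) (e i m))%:D * (x j * Gam i))); last first.
  by move=> i _; rewrite (mulrA (x j) (ofUbar _ _)) x_ofUbar -(mulrA _ (x j)).
rewrite !(bigD1 j (P :=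
  predT)) //= shift_equo_id_coef -(mulrA _ (Gam j)) Gamma_x_diag.
rewrite mulrBr mulrDr (mulrA _ (ofUbar _ _) (x j)) -rmorphM.
rewrite [X in _ = _ + X + _](_ : _ =
  \sum_(i < n | i != j) (e i m)%:D * Gam i * x j
  - (e j m)%:D * \sum_(i < n | i != j) (hd i j)^-1%:D * (x j * Gam i));
    last first.
  rewrite mulr_sumr -sumrB; apply: eq_bigr => i ij.
  rewrite -(mulrA _ (Gam i)) Gamma_x // (mulrA _ _ (x j * _)) (mulrA _ _ (x j *
    _)).
  rewrite -!rmorphM -mulrBl -rmorphB; congr (_%:D * _).
  by rewrite shift_equo_coef // rmorphN1; ring.
by rewrite [in RHS]addrAC -!addrA; congr (_ + (_ + _)); rewrite addrC.
Qed.

Lemma sum_Gamma_d j m :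
  (\sum_(i < n) (e i m)%:D * Gam i) * d j =
  d j * (\sum_(i < n) (e i m)%:D * Gam i) - d j * (e j m * Delta j sigma)%:D.
Proof.
rewrite mulr_suml mulr_sumr.
rewrite [in RHS](eq_bigr (fun i => (shift j 1 (e i m))%:D * (d j * Gam i)));
  last first.
  by move=> i _; rewrite (mulrA (d j) (ofUbar _ _)) d_ofUbar -(mulrA _ (d j)).
rewrite !(bigD1 j (P :=
  predT)) //= shift_equo_id_coef -(mulrA _ (Gam j)) Gamma_d_diag.
rewrite mulrDr mulrBr (mulrA _ (d j) (ofUbar _ _)) ofUbar_d shift_equo_id_coef.
rewrite -(mulrA (d j)) -rmorphM.
rewrite [X in _ = _ + X - _](_ : _ =
  \sum_(i < n | i != j) (e i m)%:D * Gam i * d j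
  + (e j m)%:D * \sum_(i < n | i != j) (hd i j)^-1%:D * (d j * Gam i));
    last first.
  rewrite mulr_sumr -big_split; apply: eq_bigr => i ij /=.
  rewrite -(mulrA _ (Gam i)) Gamma_d // (mulrA _ _ (d j * _)) (mulrA _ _ (d j *
    _)).
  rewrite -!rmorphM -mulrDl -rmorphD; congr (_%:D * _).
  by rewrite shift_equo_coef // mulr1z; ring.
by rewrite [in RHS]addrAC -!addrA; congr (_ + (_ + _)); rewrite addrC.
Qed.

Lemma ccoef_x rho k j :
  ccoef sigma rho k * x j - x j * ccoef sigma rho k =
  (Delta j sigma * e j k - (rho`_k - shift j (-1) rho`_k))%:D * x j.
Proof.
rewrite /ccoef mulrBl mulrBr sum_Gamma_x x_ofUbar.
move: (shift j (-1) rho`_k) (rho`_k) (Delta j sigma) => r' r s.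
rewrite !rmorphB !mulrBl (mulrC s); move: (x j * _) => v.
by rewrite [v + _]addrC -!addrA; congr (_ + _);
  rewrite !opprB addrCA [v + _]addrC subrK addrC.
Qed.

Lemma ccoef_d rho k j :
  ccoef sigma rho k * d j - d j * ccoef sigma rho k =
  d j * (rho`_k - shift j (-1) rho`_k - Delta j sigma * e j k)%:D.
Proof.
rewrite /ccoef mulrBl mulrBr sum_Gamma_d ofUbar_d.
move: (shift j (-1) rho`_k) (rho`_k) (Delta j sigma) => r' r s.
rewrite !rmorphB !mulrBr (mulrC s); move: (d j * \sum_(_ < _) _) => v.
rewrite opprB -!addrA addrC !addrA subrK [LHS]addrC [- _ - _]addrC addrA //.
Qed.

Lemma central_solves rho : solves sigma rho -> forall k,
  central (ccoef sigma rho k).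
Proof.
move=> S k.
have Sk j : Delta j sigma * e j k = rho`_k - shift j (-1) rho`_k.
  have := congr1 (fun r : {poly Ub} => r`_k) (S j).
  by rewrite /Deltat coefB coef_map coefZ.
apply: Diff_ind => [p|j|j|y Ey|y z Ey Ez|y z Ey Ez].
- rewrite /ccoef mulrBl mulrBr -!rmorphM mulrC; congr (_ - _).
  rewrite mulr_suml mulr_sumr; apply: eq_bigr => i _.
  by rewrite -mulrA -ofUbar_Gamma !mulrA -!rmorphM mulrC.
- by apply/eqP; rewrite -subr_eq0 ccoef_x Sk subrr rmorph0 mul0r.
- by apply/eqP; rewrite -subr_eq0 ccoef_d Sk subrr rmorph0 mulr0.
- by rewrite mulrN mulNr Ey.
- by rewrite (mulrDl y z) mulrDr Ey Ez.
- by rewrite (mulrA _ y) Ey -(mulrA y) Ez (mulrA y).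
Qed.

End DiffTheory.

(** * The action on polynomials over Ubar *)

(** The variables 'X_k stand for the central elements c_k, so only coefficients are shifted. *)
HB.lock Definition mshift (K : fieldType) n (j : 'I_n) (a : int)
  (f : {mpoly (Ubar K n)[n]}) : {mpoly (Ubar K n)[n]} :=
    map_mpoly (shift j a) f.

Section Representation.
Variables (K : fieldType) (n : nat).
Local Notation Ub := (Ubar K n).
Local Notation h := (@hvar K n).
Local Notation hd := (@hdiff K n).
Local Notation R := {mpoly Ub[n]}.
Local Notation e i k := ((equo K i)`_k).
Implicit Types (i j k l : 'I_n) (a b : int) (p q : Ub) (f g : R).

Fact mshift_zmod j a : zmod_morphism (@mshift K n j a).
Proof. by rewrite unlock; exact: raddfB. Qed.
Fact mshift_monoid j a : monoid_morphism (@mshift K n j a).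
Proof. by rewrite unlock; split; [exact: rmorph1|exact: rmorphM]. Qed.
HB.instance Definition _ j a :=
  GRing.isZmodMorphism.Build R R (@mshift K n j a) (mshift_zmod j a).
HB.instance Definition _ j a :=
  GRing.isMonoidMorphism.Build R R (@mshift K n j a) (mshift_monoid j a).

Lemma mshiftZ j a p f : mshift j a (p *: f) = shift j a p *: mshift j a f.
Proof. by rewrite unlock; exact: map_mpolyZ. Qed.

Lemma mshiftM j a f g : mshift j a (f * g) = mshift j a f * mshift j a g.
Proof. exact: rmorphM. Qed.

Lemma mshiftX j a k : mshift j a 'X_k = 'X_k :> R.
Proof. by rewrite unlock; exact: map_mpolyX. Qed.

Lemma mshiftC j a p : mshift j a p%:MP = (shift j a p)%:MP.
Proof. by rewrite unlock; exact: map_mpolyC. Qed.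

Lemma mcoeff_mshift j a f m : (mshift j a f)@_m = shift j a f@_m.
Proof. by rewrite unlock; exact: mcoeff_map_mpoly. Qed.

Lemma mshift_comm i j a b f : mshift i a (mshift j b f) =
  mshift j b (mshift i a f).
Proof. by apply/mpolyP => m; rewrite !mcoeff_mshift shiftC. Qed.

Lemma mshiftK j f : mshift j (-1) (mshift j 1 f) = f.
Proof. by apply/mpolyP => m; rewrite !mcoeff_mshift shiftK. Qed.

Lemma mshiftNK j f : mshift j 1 (mshift j (-1) f) = f.
Proof. by apply/mpolyP => m; rewrite !mcoeff_mshift shiftNK. Qed.

Lemma scaler_congr p q f : p = q -> p *: f = q *: f.
Proof. by move=> ->. Qed.

Lemma mulr_rot p q (t : Ub) : p * (q * t) = t * q * p.
Proof. by rewrite mulrC [q * t]mulrC. Qed.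

Lemma scaler_mul3 p q (t : Ub) f g (r : R) :
  p *: (f * (q *: ((t *: g) * r))) = (p * q * t) *: (f * g * r).
Proof. by rewrite -scalerAl scalerA -scalerAr scalerA !mulrA. Qed.

(* Rescaling by the gauge turns the x^j into commuting operators, the shifts. *)
Definition gauge j : Ub := \prod_(k < n | (k < j)%N) (hd k j)^-1.

Lemma gauge_unit j : gauge j \is a GRing.unit.
Proof.
apply: rpred_prod => k kj; rewrite unitrV hdiff_unit //.
by apply: contraTneq kj => ->; rewrite ltnn.
Qed.

Lemma shift_gauge_gt i j a : (j < i)%N -> shift i a (gauge j) = gauge j.
Proof.
move=> ji; rewrite rmorph_prod; apply: eq_bigr => k kj /=.
have neq (l l' : 'I_n) : (l < l')%N -> l != l' by apply: contraTneq => ->;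
  rewrite ltnn.
rewrite shiftV ?hdiff_unit ?neq // shift_hdiff.
by rewrite (negbTE (neq _ _ (ltn_trans kj ji))) (negbTE (neq _ _ ji)) addr0
  subr0.
Qed.

(** Only the factor of index i in [gauge j] involves h_i when i < j. For j < i there is no such
    factor, and this asymmetry produces the coefficient in the x-x relation. *)
Lemma shift_gauge_lt i j a : (i < j)%N ->
  shift i a (gauge j) = gauge j * (hd i j / (hd i j + a%:~R)).
Proof.
move=> lt_ij; have neq (l l' : 'I_n) : (l < l')%N -> l != l'.
  by apply: contraTneq => ->; rewrite ltnn.
have ij := neq _ _ lt_ij.
rewrite /gauge (bigD1 i) //= rmorphM /= shiftV ?hdiff_unit // shift_hdiffl //.
rewrite [_^-1 * \prod_(_ < _ | _) _ in RHS]mulrC -mulrA mulKr ?hdiff_unit //.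
rewrite mulrC; congr (_ * _); rewrite rmorph_prod;
  apply: eq_bigr => k /andP [kj ki] /=.
rewrite shiftV ?hdiff_unit ?neq // shift_hdiff (negbTE ki) addr0.
by rewrite eq_sym (negbTE ij) subr0.
Qed.
End Representation.

(** * Operators for the generators and the defining relations *)

Section Action.
Variables (K : fieldType) (n : nat) (sigma : Ubar K n) (rho : {poly Ubar K n}).
Hypothesis S : solves sigma rho.
Local Notation Ub := (Ubar K n).
Local Notation h := (@hvar K n).
Local Notation hd := (@hdiff K n).
Local Notation R := {mpoly Ub[n]}.
Local Notation e i k := ((equo K i)`_k).
Implicit Types (i j k l : 'I_n) (a b : int) (p q : Ub) (f g : R).

(* The value of Gamma_i, with 'X_k standing for c_k. *)
Definition GammaR i : R := \sum_(k < n) lagrange K i k *: ('X_k + (rho`_k)%:MP).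

Lemma equo_GammaR (m : 'I_n) : \sum_(i < n) e i m *: GammaR i =
  'X_m + (rho`_m)%:MP.
Proof.
pose F (k : 'I_n) : R := 'X_k + (rho`_k)%:MP.
rewrite (eq_bigr (fun i => \sum_(k < n) (e i m * lagrange K i k) *: F k));
  last first.
  by move=> i _; rewrite scaler_sumr; apply: eq_bigr => k _; rewrite scalerA.
rewrite exchange_big (bigD1 m) //= -scaler_suml equoK eqxx scale1r.
rewrite big1 ?addr0 // => k km.
by rewrite -scaler_suml equoK eq_sym (negbTE km) scale0r.
Qed.

(** The Lagrange coefficients recover each F i from the given combinations. *)
Lemma equo_free (F F' : 'I_n -> R) :
  (forall m : 'I_n, \sum_(i < n) e i m *: F i =
    \sum_(i < n) e i m *: F' i) -> F =1 F'.
Proof.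
have inv (H : 'I_n -> R) i :
    H i = \sum_(m < n) lagrange K i m *: (\sum_(j < n) e j m *: H j).
  rewrite (eq_bigr (fun m : 'I_n =>
    \sum_(j < n) (lagrange K i m * e j m) *: H j)); last first.
    by move=> m _; rewrite scaler_sumr; apply: eq_bigr => j _; rewrite scalerA.
  rewrite exchange_big (bigD1 i) //= -scaler_suml lagrangeK eqxx scale1r.
  rewrite big1 ?addr0 // => k km.
  by rewrite -scaler_suml lagrangeK eq_sym (negbTE km) scale0r.
by move=> E i; rewrite inv [RHS]inv; apply: eq_bigr => m _; rewrite E.
Qed.

(* Applying the shift to equo_GammaR and comparing coefficients of the linearly
   independent quotients e(t)/(1 + h_i t). *)
Lemma GammaR_mshift j i :
  GammaR i = if i == j then mshift j (-1) (GammaR j)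
          - \sum_(k < n | k != j) (hd k j)^-1 *: mshift j (-1) (GammaR k)
          + (Delta j sigma)%:MP
        else (1 + (hd i j)^-1) *: mshift j (-1) (GammaR i).
Proof.
move: i; pose F' i : R := if i == j then mshift j (-1) (GammaR j)
          - \sum_(k < n | k != j) (hd k j)^-1 *: mshift j (-1) (GammaR k)
          + (Delta j sigma)%:MP
        else (1 + (hd i j)^-1) *: mshift j (-1) (GammaR i).
apply: (@equo_free GammaR F') => m; rewrite equo_GammaR /F'.
have := congr1 (fun r : {poly Ub} => r`_m) (S j).
rewrite /Deltat coefB coef_map coefZ /= => /eqP; rewrite subr_eq => /eqP E.
have : mshift j (-1) (\sum_(i < n) e i m *: GammaR i) =
  'X_m + (shift j (-1) rho`_m)%:MP.
  by rewrite equo_GammaR rmorphD /= mshiftX mshiftC.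
move=> H; rewrite E mpolyCD addrCA -H.
rewrite rmorph_sum /= [in LHS](bigD1 j) //= [in RHS](bigD1 j) //= eqxx.
rewrite [X in _ = _ + X](eq_bigr (fun i =>
  (e i m * (1 + (hd i j)^-1)) *: mshift j (-1) (GammaR i))); last first.
  by move=> i /negbTE ->; rewrite scalerA.
(* [shift_equo_coef] rewrites the shifted quotients in terms of the original ones; the resulting
   multiples of [e j m] are gathered at index j. *)
rewrite [X in _ + (_ + X) = _](_ : _ =
  \sum_(i < n | i != j) (e i m * (1 + (hd i j)^-1)) *: mshift j (-1) (GammaR i)
  - e j m *: \sum_(k < n | k != j) (hd k j)^-1 *: mshift j (-1) (GammaR k));
    last first.
  rewrite scaler_sumr -sumrB; apply: eq_bigr => i ij.
  rewrite mshiftZ scalerA -scalerBl; congr (_ *: _).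
  by rewrite shift_equo_coef // rmorphN1; ring.
rewrite mshiftZ shift_equo_id_coef mulrC mpolyCM mul_mpolyC.
by rewrite scalerDr scalerBr addrC addrA [RHS]addrAC; congr (_ + _);
  rewrite addrAC.
Qed.

Lemma mshiftN1_GammaR i j : i != j -> mshift j (-1) (GammaR i) =
  (hd i j / (hd i j + 1)) *: GammaR i.
Proof.
move=> ij; rewrite [GammaR i in RHS](GammaR_mshift j) (negbTE ij) scalerA.
rewrite -[LHS]scale1r; congr (_ *: _).
have [y1 z1 yz] := partial_fraction (hdiff_unit K ij) (hdiffD1_unit K ij).
by rewrite mulrDr mulr1 z1 mulrBl mul1r [_ * (hd i j)^-1]mulrC yz opprB addrC;
  ring.
Qed.

Lemma mshift1_GammaR i j : i != j -> mshift j 1 (GammaR i) =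
  (hd i j / (hd i j - 1)) *: GammaR i.
Proof.
move=> ij; have u := hdiffB1_unit K ij; have u0 := hdiff_unit K ij.
have E := congr1 (mshift j 1) (mshiftN1_GammaR ij);
  rewrite mshiftNK mshiftZ in E.
rewrite {2}E scalerA shiftM shiftV ?hdiffD1_unit //.
rewrite (shiftDl _ _ (hd i j)) rmorph1 shift_hdiffr // mulr1z subrK.
by rewrite -[LHS]scale1r -(mulrA (hd i j)) mulKr // divrr.
Qed.

(** This is how x^i d_i will act. It comes from solving [GammaR_mshift] at i = j for the shifted
    term, and it mirrors the defining relation of x^i d_i. *)
Lemma mshiftN1_GammaR_diag i :
  mshift i (-1) (GammaR i) =
    \sum_(j < n) (1 - hd i j)^-1 *: GammaR j - (Delta i sigma)%:MP.
Proof.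
have := GammaR_mshift i i; rewrite eqxx => E.
rewrite (bigD1 i) //= hdiffii subr0 invr1 scale1r [X in _ = X + _ - _]E.
rewrite [X in _ - X + _](eq_bigr (fun k => (1 - hd i k)^-1 *: GammaR k));
  last first.
  move=> k ki; rewrite mshiftN1_GammaR // scalerA mulrA mulVr ?hdiff_unit //
    mul1r.
  by rewrite (hdiffC K i k) opprK addrC.
by rewrite addrAC addrK subrK.
Qed.

(** The action is first given on terms and descends to the quotient by [act_cong]. The gauge factors
    are placed so that d_j x^j multiplies by [GammaR j]. *)
Fixpoint act (t : term K n) : R -> R :=
  match t with
  | TU p => fun f => p *: f
  | TX j => fun f => mshift j (-1) (gauge K j *: f)
  | TD j => fun f => (gauge K j)^-1 *: (GammaR j * mshift j 1 f)
  | TOpp s => fun f => - act s f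
  | TAdd s t => fun f => act s f + act t f
  | TMul s t => fun f => act s (act t f)
  end.

Lemma actD t f g : act t (f + g) = act t f + act t g.
Proof.
elim: t f g => [p|j|j|s IH|s IHs t IHt|s IHs t IHt] f g /=.
- exact: scalerDr.
- by rewrite scalerDr rmorphD.
- by rewrite rmorphD mulrDr scalerDr.
- by rewrite IH opprD.
- by rewrite IHs IHt addrACA.
- by rewrite IHt IHs.
Qed.

Lemma act_big (F : 'I_n -> term K n) f :
  act (\big[@TAdd K n/TU 0]_(j < n) F j) f = \sum_(j < n) act (F j) f.
Proof. by apply: (big_morph (fun t => act t f)) => //=; rewrite scale0r. Qed.

Lemma act_cX c j f :
  cst n c *: mshift j (-1) (gauge K j *: f) =
    mshift j (-1) (gauge K j *: (cst n c *: f)).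
Proof. by rewrite !mshiftZ shift_cst !scalerA mulrC. Qed.

Lemma act_cD c j f : cst n c *: ((gauge K j)^-1 *: (GammaR j * mshift j 1 f)) =
  (gauge K j)^-1 *: (GammaR j * mshift j 1 (cst n c *: f)).
Proof. by rewrite mshiftZ shift_cst -scalerAr !scalerA mulrC. Qed.

Lemma shift_hvar_delta i j a :
  shift j a (h i - (a *+ (i == j))%:~R) = h i.
Proof.
rewrite (shiftDl _ _ (h i)) rmorphN rmorph_int shift_hvar.
by case: eqP => _; rewrite ?mulr0n ?mulr1n ?rmorph0 ?subr0 ?addr0 ?addrK.
Qed.

Lemma act_hX i j f : h i *: mshift j (-1) (gauge K j *: f) =
  mshift j (-1) (gauge K j *: ((h i + (i == j)%:R) *: f)).
Proof.
(* Puts the argument in the form of [shift_hvar_delta] with a = -1. *)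
have -> : h i + (i == j)%:R = h i - (- 1 *+ (i == j))%:~R.
  by rewrite mulNrn rmorphN opprK rmorph_nat.
by rewrite !mshiftZ shift_hvar_delta !scalerA mulrC.
Qed.

Lemma act_hD i j f : h i *: ((gauge K j)^-1 *: (GammaR j * mshift j 1 f)) =
  (gauge K j)^-1 *: (GammaR j * mshift j 1 ((h i - (i == j)%:R) *: f)).
Proof.
have -> : h i - (i == j)%:R = h i - (1 *+ (i == j))%:~R by rewrite rmorph_nat.
by rewrite !mshiftZ shift_hvar_delta -scalerAr !scalerA mulrC.
Qed.

Lemma neq_ltn_ord i j : (i < j)%N -> i != j.
Proof. by apply: contraTneq => ->; rewrite ltnn. Qed.

Lemma shiftB_ratio i j : i != j -> shift j (-1) (hd i j / (hd i j - 1)) =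
  (hd i j + 1) / hd i j.
Proof.
move=> ij; rewrite shiftM shiftV ?hdiffB1_unit // (shiftDl _ _ (hd i j))
  rmorphN1.
by rewrite shift_hdiffr // rmorphN1 opprK addrK.
Qed.

Lemma divr_mulK (p q r : Ub) : q \is a GRing.unit -> r \is a GRing.unit ->
  p / (q * r) * r = p / q.
Proof. by move=> uq ur; rewrite invrM // mulrA mulrAC divrK. Qed.

Lemma ratioNB i j : hd j i / (hd j i - 1) = hd i j / (hd i j + 1).
Proof. by rewrite (hdiffC K j i) -opprD invrN mulrNN. Qed.

Lemma ratioND i j : hd j i / (hd j i + 1) = hd i j / (hd i j - 1).
Proof. by rewrite [RHS]ratioNB. Qed.

(** The shifts commute; the coefficient arises because shifting h_i changes [gauge K j] while
    shifting h_j fixes [gauge K i]. *)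
Lemma act_XX i j f : (i < j)%N ->
  mshift i (-1) (gauge K i *: mshift j (-1) (gauge K j *: f)) =
  ((hd i j + 1) / hd i j) *: mshift j (-1) (gauge K j *: mshift i (-1) (gauge K
    i *: f)).
Proof.
move=> lt_ij; rewrite !mshiftZ mshift_comm !scalerA; apply: scaler_congr.
rewrite [X in _ * X]shiftC (shift_gauge_lt _ _ lt_ij) shiftM rmorphN1.
rewrite (shiftB_ratio (neq_ltn_ord lt_ij)) [X in _ =
  _ * X]shiftC (shift_gauge_gt _ _ lt_ij).
exact: mulr_rot.
Qed.

(** On the left the change of [gauge K j] cancels that of [GammaR j]; on the right the stated
    coefficient cancels the change of [GammaR i]. *)
Lemma act_DD i j f : (i < j)%N ->
  (gauge K i)^-1 *: (GammaR i * mshift i 1 ((gauge K j)^-1 *: (GammaR j *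
    mshift j 1 f))) =
  ((hd i j - 1) / hd i j) *:
    ((gauge K j)^-1 *: (GammaR j * mshift j 1 ((gauge K i)^-1 *: (GammaR i *
      mshift i 1 f)))).
Proof.
move=> lt_ij; have ij := neq_ltn_ord lt_ij; have ji : j != i by rewrite eq_sym.
rewrite !mshiftZ !mshiftM (mshift1_GammaR ij) (mshift1_GammaR ji) mshift_comm
  !shiftV ?gauge_unit //.
rewrite (shift_gauge_lt _ _ lt_ij) (shift_gauge_gt _ _ lt_ij) mulr1z.
rewrite !scaler_mul3 scalerA (mulrC (GammaR j) (GammaR i)); apply: scaler_congr.
rewrite ratioNB divr_mulK ?gauge_unit ?unitrM ?unitrV ?hdiff_unit ?hdiffD1_unit
  //.
have E : (hd i j - 1) / hd i j * (hd i j / (hd i j - 1)) = 1.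
  by rewrite mulrA divrK ?hdiff_unit // divrr ?hdiffB1_unit.
by rewrite [RHS]mulrCA E mulr1 mulrC.
Qed.

(** Shifting h_i changes [gauge K j] and [GammaR j] by the same factor, which cancels in their
    quotient. *)
Lemma act_XD_lt i j f : (i < j)%N ->
  mshift i (-1) (gauge K i *: ((gauge K j)^-1 *: (GammaR j * mshift j 1 f))) =
  (gauge K j)^-1 *: (GammaR j * mshift j 1 (mshift i (-1) (gauge K i *: f))).
Proof.
move=> lt_ij; have ij := neq_ltn_ord lt_ij; have ji : j != i by rewrite eq_sym.
rewrite !mshiftZ mshiftM (mshiftN1_GammaR ji) mshift_comm shiftV ?gauge_unit //.
rewrite (shift_gauge_lt _ _ lt_ij) [shift j 1 _]shiftC (shift_gauge_gt _ _
  lt_ij).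
rewrite -!scalerAl -?scalerAr !scalerA.
apply: scaler_congr.
rewrite rmorphN1 ratioND divr_mulK ?gauge_unit ?unitrM ?unitrV ?hdiff_unit
  ?hdiffB1_unit //.
by rewrite mulrC.
Qed.

(** Here [gauge K j] is fixed. The left side gains h_ij / (h_ij - 1) from [GammaR j], the right side
    (h_ij - 1) / (h_ij - 2) from [gauge K i]; the coefficient is their ratio. *)
Lemma act_XD_gt i j f : (j < i)%N ->
  mshift i (-1) (gauge K i *: ((gauge K j)^-1 *: (GammaR j * mshift j 1 f))) =
  (hd i j * (hd i j - 2%:R) / (hd i j - 1) ^+ 2) *:
  ((gauge K j)^-1 *: (GammaR j * mshift j 1 (mshift i (-1) (gauge K i *: f)))).
Proof.
move=> lt_ij; have ji := neq_ltn_ord lt_ij; have ij : i != j by rewrite eq_sym.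
rewrite !mshiftZ mshiftM (mshiftN1_GammaR ji) mshift_comm shiftV ?gauge_unit //.
rewrite (shift_gauge_gt _ _ lt_ij) [shift j 1 _]shiftC (shift_gauge_lt _ _
  lt_ij).
rewrite -!scalerAl -?scalerAr !scalerA.
apply: scaler_congr.
have E : shift i (-1) (hd i j - 1) = hd i j - 2%:R.
  rewrite (shiftDl _ _ (hd i j)) rmorphN1 shift_hdiffl // rmorphN1.
  by rewrite -(addrA (hd i j)) -opprD.
rewrite mulr1z ratioND shiftM shiftM shiftV ?hdiffB1_unit // E.
rewrite shift_hdiffl // rmorphN1.
transitivity (shift i (-1) (gauge K i) / gauge K j *
  (hd i j / (hd i j - 1) * ((hd i j - 1) / (hd i j - 1)) * ((hd i j - 2%:R) /
    (hd i j - 2%:R)))).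
  by rewrite (divrr (hdiffB1_unit K ij)) (divrr (hdiffB2_unit K ij)) !mulr1.
by rewrite -exprVn; ring.
Qed.

Lemma act_XD_eq i f :
  mshift i (-1) (gauge K i *: ((gauge K i)^-1 *: (GammaR i * mshift i 1 f))) =
  \sum_(j < n) (1 - hd i j)^-1 *:
     ((gauge K j)^-1 *: (GammaR j * mshift j 1 (mshift j (-1) (gauge K j *:
       f))))
  - Delta i sigma *: f.
Proof.
rewrite scalerA divrr ?gauge_unit // scale1r rmorphM /= mshiftK
  mshiftN1_GammaR_diag.
rewrite mulrBl mul_mpolyC mulr_suml; congr (_ - _); apply: eq_bigr => j _.
by rewrite mshiftNK -scalerAr (scalerA _^-1 (gauge K j)) mulVr ?gauge_unit //
  scale1r scalerAl.
Qed.

Lemma act_rel s t : rel_gen sigma s t -> act s =1 act t.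
Proof.
case=> {s t} [c j|c j|i j|i j|i j ij|i j ij|i j ij|i j ij|i] f /=.
- exact: act_cX.
- exact: act_cD.
- exact: act_hX.
- exact: act_hD.
- exact: act_XX.
- exact: act_DD.
- exact: act_XD_lt.
- exact: act_XD_gt.
- by rewrite act_big; exact: act_XD_eq.
Qed.

Lemma act_cong s t : cong sigma s t -> act s =1 act t.
Proof.
elim=> {s t} //=.
- by move=> s t /act_rel.
- by move=> s t _ E f; rewrite E.
- by move=> s t u _ E _ E' f; rewrite E E'.
- by move=> s t _ E f; rewrite E.
- by move=> s t u v _ E _ E' f; rewrite E E'.
- by move=> s t u v _ E _ E' f; rewrite E E'.
- by move=> s t u f; rewrite addrA.
- by move=> s t f; rewrite addrC.
- by move=> s f; rewrite scale0r add0r.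
- by move=> s f; rewrite addNr scale0r.
- by move=> s f; rewrite scale1r.
- by move=> s f; rewrite scale1r.
- by move=> s t u f; rewrite actD.
- by move=> p q f; rewrite scalerDl.
- by move=> p q f; rewrite scalerA.
Qed.
End Action.

(** * The induced action of the quotient ring *)

Section DiffAction.
Local Open Scope quotient_scope.
Variables (K : fieldType) (n : nat) (sigma : Ubar K n) (rho : {poly Ubar K n}).
Hypothesis S : solves sigma rho.
Local Notation Ub := (Ubar K n).
Local Notation D := (Diff sigma).
Local Notation R := {mpoly Ub[n]}.
Local Notation "p %:D" :=
  (ofUbar sigma p) (at level 2, left associativity, format "p %:D").
Local Notation x := (xgen sigma).
Local Notation d := (dgen sigma).
Local Notation Gam := (@Gamma K n sigma).
Implicit Types (i j k l : 'I_n) (a b : int) (p q : Ub) (f g : R) (z : D).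

Definition dact z : R -> R := act rho (repr z).

Lemma dact_pi t : dact (\pi_D t) =1 act rho t.
Proof. by move=> f; rewrite /dact (act_cong S (cong_repr sigma t)). Qed.

Lemma dactU p f : dact p%:D f = p *: f.
Proof. exact: dact_pi. Qed.

Lemma dact_x j f : dact (x j) f = mshift j (-1) (gauge K j *: f).
Proof. exact: dact_pi. Qed.

Lemma dact_d j f : dact (d j) f =
  (gauge K j)^-1 *: (GammaR rho j * mshift j 1 f).
Proof. exact: dact_pi. Qed.

Lemma dactD z z' f : dact (z + z') f = dact z f + dact z' f.
Proof.
elim/quotW: z => s; elim/quotW: z' => t.
by rewrite -pi_TAdd !dact_pi.
Qed.

Lemma dactN z f : dact (- z) f = - dact z f.
Proof. by elim/quotW: z => s; rewrite -pi_TOpp !dact_pi. Qed.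

Lemma dactM z z' f : dact (z * z') f = dact z (dact z' f).
Proof.
elim/quotW: z => s; elim/quotW: z' => t.
by rewrite -pi_TMul !dact_pi.
Qed.

Lemma dact0 f : dact 0 f = 0.
Proof. by rewrite -(rmorph0 (ofUbar sigma)) dactU scale0r. Qed.

Lemma dact1 f : dact 1 f = f.
Proof. by rewrite -(rmorph1 (ofUbar sigma)) dactU scale1r. Qed.

Lemma dact_sum (I : Type) (r : seq I) (P : pred I) (F : I -> D) f :
  dact (\sum_(i <- r | P i) F i) f = \sum_(i <- r | P i) dact (F i) f.
Proof.
by apply: (big_morph (fun z => dact z f)); [move=> y z;
  apply: dactD|apply: dact0].
Qed.

Lemma dact_Gamma i f : dact (Gam i) f = GammaR rho i * f.
Proof.
rewrite /Gamma dactM dact_d dact_x mshiftNK -scalerAr scalerA mulVr ?scale1r //.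
exact: gauge_unit.
Qed.

Lemma dact_ccoef k f : dact (ccoef sigma rho k) f = 'X_k * f.
Proof.
rewrite /ccoef dactD dactN dactU dact_sum.
rewrite (eq_bigr (fun i => ((equo K i)`_k *: GammaR rho i) * f)); last first.
  by move=> i _; rewrite dactM dactU dact_Gamma scalerAl.
by rewrite -mulr_suml equo_GammaR mulrDl mul_mpolyC addrK.
Qed.

Lemma Diff_neq0 : (1 : D) != 0.
Proof.
apply/eqP => E; have := dact1 1; rewrite E dact0 => /esym/eqP.
by rewrite oner_eq0.
Qed.

(** Applied to 1, the product gives the constant u times a shifted gauge factor, which is a unit. *)
Lemma ofUbar_x_eq0 u j : u%:D * x j = 0 -> u = 0.
Proof.
move=> /(congr1 (fun z => dact z 1));
  rewrite dactM dactU dact_x dact0 mshiftZ rmorph1.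
move=> /(congr1 (mcoeff 0%MM)); rewrite mcoeff0 !mcoeffZ mcoeff1 eqxx mulr1.
have ug : shift j (-1) (gauge K j) \is a GRing.unit.
  exact: (rmorph_unit (@shift K n j (-1)) (gauge_unit K j)).
by move=> E; rewrite -[u](mulrK ug) E mul0r.
Qed.
End DiffAction.

(* mmap needs a non-trivial target ring, and Diff sigma is known to be one only
   through its action: the proof is carried as a phantom parameter. *)
Definition DiffNz (K : fieldType) (n : nat) (sigma : Ubar K n)
  (nz : (1 : Diff sigma) != 0) : Type := Diff sigma.

HB.instance Definition _ K n sigma nz :=
  GRing.PzRing.copy (@DiffNz K n sigma nz) (Diff sigma).
HB.instance Definition _ K n sigma nz :=
  GRing.PzSemiRing_isNonZero.Build (@DiffNz K n sigma nz) nz.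
Definition ofUbarNz K n sigma nz : Ubar K n -> @DiffNz K n sigma nz :=
  ofUbar sigma.
HB.instance Definition _ K n sigma nz :=
  GRing.RMorphism.copy (@ofUbarNz K n sigma nz) (ofUbar sigma).

(** * Words and the center *)

Section Words.
Variables (K : fieldType) (n : nat) (sigma : Ubar K n).
Local Notation Ub := (Ubar K n).
Local Notation h := (@hvar K n).
Local Notation hd := (@hdiff K n).
Local Notation D := (Diff sigma).
Local Notation "p %:D" :=
  (ofUbar sigma p) (at level 2, left associativity, format "p %:D").
Local Notation x := (xgen sigma).
Local Notation d := (dgen sigma).
Local Notation letter := ('I_n * bool)%type.
Implicit Types (i j k l : 'I_n) (a b : int) (p q : Ub) (z : D) (g : letter) (w
  v : seq letter).

(* A letter (i, true) stands for x^i and (i, false) for d_i. *)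
Definition gen g : D := if g.2 then x g.1 else d g.1.
Definition sgn g : int := if g.2 then 1 else -1.
Definition wprod w : D := foldr (fun g z => gen g * z) 1 w.
Definition weight w i : int := \sum_(g <- w | g.1 == i) sgn g.

Lemma wprod_nil : wprod [::] = 1. Proof. by []. Qed.
Lemma wprod_cons g w : wprod (g :: w) = gen g * wprod w. Proof. by []. Qed.
Lemma wprod_cat w v : wprod (w ++ v) = wprod w * wprod v.
Proof. by elim: w => [|g w IH] /=; rewrite ?mul1r // IH mulrA. Qed.
Lemma weight_nil i : weight [::] i = 0. Proof. exact: big_nil. Qed.
Lemma weight_cons g w i : weight (g :: w) i =
  (if g.1 == i then sgn g else 0) + weight w i.
Proof. by rewrite /weight big_cons; case: ifP; rewrite ?add0r. Qed.
Lemma weight_filter i w : weight [seq g <- w | g.1 == i] i = weight w i.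
Proof. by rewrite /weight big_filter_cond; apply: eq_bigl => g;
  rewrite andbb. Qed.
Lemma weight_filterC i j w :
  weight [seq g <- w | g.1 != i] j = if j != i then weight w j else 0.
Proof.
rewrite /weight big_filter_cond; case: eqVneq => [->|ji] /=.
  by rewrite big1 // => g /andP [/negbTE ->].
by apply: eq_bigl => g; case: (eqVneq g.1 j) => [->|_]; rewrite ?ji ?andbF.
Qed.

Lemma gen_ofUbar g p : gen g * p%:D = (shift g.1 (- sgn g) p)%:D * gen g.
Proof. by case: g => i [] /=;
  rewrite /gen /sgn /= ?x_ofUbar ?d_ofUbar ?opprK. Qed.

Lemma gen_swap g g' : g.1 != g'.1 ->
  exists u, gen g * gen g' = u%:D * (gen g' * gen g).
Proof.
case: g g' => i [] [j []] /= ij; rewrite /gen /=;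
  have ji : j != i by rewrite eq_sym.
- by eexists; apply: xx_neq.
- by eexists; apply: xd_neq.
(* The relations express x^j d_i through d_i x^j; the coefficient is a unit, so they can be
   inverted. *)
- have /ofUbar_swap E := xd_neq sigma ji; eexists; apply: E.
  case: ifP => _; first exact: unitr1.
  by rewrite !(unitrM, unitrV, unitrX) ?hdiff_unit ?hdiffB1_unit ?hdiffB2_unit.
- by eexists; apply: dd_neq.
Qed.

Lemma gen_wprod_swap g v : all (fun g' => g'.1 != g.1) v ->
  exists u, gen g * wprod v = u%:D * (wprod v * gen g).
Proof.
elim: v => [|g' v IH] /=; first by exists 1; rewrite rmorph1 mulr1 !mul1r.
case/andP; rewrite eq_sym => /gen_swap [u E] /IH [u' E'].
exists (u * shift g'.1 (- sgn g') u').
rewrite mulrA E -!mulrA E' (mulrA (gen g') (u'%:D)) gen_ofUbar.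
by rewrite (rmorphM _ u) -!mulrA.
Qed.

(** Letters of different indices commute up to a factor in Ubar, and coefficients move left through
    letters, so the letters of index i can be brought to the front. *)
Lemma wprod_filter i w : exists u,
  wprod w = u%:D * wprod [seq g <- w | g.1 == i] * wprod [seq g <- w | g.1 !=
    i].
Proof.
elim: w => [|g w [u IH]] /=; first by exists 1; rewrite rmorph1 !mul1r.
case: eqVneq => [gi|gi] /=.
  exists (shift g.1 (- sgn g) u).
  by rewrite IH !mulrA gen_ofUbar.
have [|u' E] := @gen_wprod_swap g [seq g <- w | g.1 == i].
  apply/allP => g'; rewrite mem_filter => /andP [/eqP -> _].
  by rewrite eq_sym.
exists (shift g.1 (- sgn g) u * u').
rewrite IH !mulrA gen_ofUbar (rmorphM _ _ u') -!mulrA; congr (_ * _).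
by rewrite (mulrA (gen g)) E -!mulrA.
Qed.

Lemma wprod_ofUbar w p : exists q, wprod w * p%:D = q%:D * wprod w.
Proof.
elim: w => [|g w [q IH]] /=; first by exists p; rewrite mul1r mulr1.
by exists (shift g.1 (- sgn g) q); rewrite -mulrA IH mulrA gen_ofUbar mulrA.
Qed.

(** A word is an eigenvector for the commutator with h_i, with its weight as eigenvalue. *)
Lemma wprod_hvar w i : wprod w * (h i)%:D =
  (h i - (weight w i)%:~R)%:D * wprod w.
Proof.
elim: w => [|g w IH] /=; first by rewrite weight_nil subr0 mul1r mulr1.
rewrite -mulrA IH mulrA gen_ofUbar mulrA; congr (_%:D * _ * _).
rewrite (shiftDl _ _ (h i)) rmorphN rmorph_int shift_hvar weight_cons eq_sym.
case: eqVneq => _; last by rewrite add0r addr0.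
by rewrite rmorphN rmorphD opprD addrA.
Qed.

(** The left Ubar-span of the words is closed under products because coefficients pass through
    words. *)
Lemma word_span z : exists s : seq (Ub * seq letter),
  z = \sum_(t <- s) t.1%:D * wprod t.2.
Proof.
elim/Diff_ind: z => [p|i|i|y [s ->]|y z [s ->] [s' ->]|y z [s ->] [s' ->]].
- by exists [:: (p, [::])]; rewrite big_seq1 mulr1.
- by exists [:: (1, [:: (i, true)])]; rewrite big_seq1 rmorph1 mul1r /= mulr1.
- by exists [:: (1, [:: (i, false)])]; rewrite big_seq1 rmorph1 mul1r /= mulr1.
- exists [seq (- t.1, t.2) | t <- s]; rewrite big_map -sumrN.
  by apply: eq_bigr => t _; rewrite rmorphN mulNr.
- by exists (s ++ s'); rewrite big_cat.
elim: s => [|[u w] s [r IH]]; first by exists [::]; rewrite !big_nil mul0r.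
suff [r' E] : exists r', (u%:D * wprod w) * (\sum_(t <- s') t.1%:D * wprod t.2)
    = \sum_(t <- r') t.1%:D * wprod t.2.
  by exists (r' ++ r); rewrite big_cons mulrDl IH big_cat -E.
elim: s' {IH r s} => [|[u' w'] s' [r IH]]; first by exists [::];
  rewrite !big_nil mulr0.
have [q Eq] := wprod_ofUbar w u'.
exists ((u * q, w ++ w') :: r); rewrite !big_cons mulrDr IH /= wprod_cat.
by rewrite (rmorphM _ u) -!mulrA (mulrA (wprod w)) Eq -mulrA.
Qed.

Hypothesis hK : [pchar K] =i pred0.

(** Characteristic zero enters here, to allow division by nonzero weights. *)
Lemma int_unit (a : int) : a != 0 -> (a%:~R : Ub) \is a GRing.unit.
Proof.
move=> a0; have aK : (a%:~R : K) != 0.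
  have natK m : (m%:R == 0 :> K) = (m == 0)%N by apply: (pcharf0P _).1.
  by case: a a0 => m a0; rewrite ?NegzE ?rmorphN ?oppr_eq0 natK.
rewrite -(rmorph_int (@cst K n)); apply: rmorph_unit; by rewrite unitfE.
Qed.

(* Subtracting k^-1 [h_i, z] = 0 from z removes all the words of h_i-weight k
   and rescales the others, keeping those of weight zero. *)
Lemma weight0_part z (s : seq (Ub * seq letter)) :
  z = \sum_(t <- s) t.1%:D * wprod t.2 ->
  (forall i, (h i)%:D * z = z * (h i)%:D) ->
  exists2 s' : seq (Ub * seq letter),
    (forall t, t \in s' -> forall i, weight t.2 i = 0) &
    z = \sum_(t <- s') t.1%:D * wprod t.2.
Proof.
move=> zE zh; have [N] := ubnP (size s); elim: N s zE => // N IH s zE sN.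
have [/hasP [t0 t0s /existsP [i]]|] :=
    boolP (has (fun t => [exists i, weight t.2 i != 0]) s); last first.
  move=> /hasPn H; exists s => // t ts i; apply/eqP/negPn.
  by have := H t ts; rewrite negb_exists => /forallP.
set k := weight t0.2 i => k0; have uk := int_unit k0.
pose s' := [seq (t.1 * (1 - (weight t.2 i)%:~R / k%:~R),
  t.2) | t <- s & weight t.2 i != k].
apply: (IH s'); last first.
  (* The word of t0 has weight k and is removed, so the list gets strictly shorter. *)
  rewrite size_map size_filter; apply: (@leq_trans (size s)); last by [].
  rewrite -(count_predC (fun t =>
    weight t.2 i != k) s) -[X in (X < _)%N]addn0 ltn_add2l.
  by rewrite -has_count; apply/hasP; exists t0 => //=; rewrite negbK /k.
have : (k%:~R^-1)%:D * ((h i)%:D * z - z * (h i)%:D) = 0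
  by rewrite zh subrr mulr0.
have -> : (h i)%:D * z - z * (h i)%:D =
    \sum_(t <- s) (t.1 * (weight t.2 i)%:~R)%:D * wprod t.2.
  rewrite zE mulr_sumr mulr_suml -sumrB; apply: eq_bigr => t _.
  rewrite -(mulrA _ (wprod _)) wprod_hvar !mulrA -!rmorphM -mulrBl -rmorphB.
  by congr (_%:D * _); ring.
rewrite mulr_sumr => /(congr1 (fun y => z - y)); rewrite subr0 => <-.
rewrite [in LHS]zE -sumrB /s' big_map big_filter [in RHS]big_mkcond /=.
apply: eq_bigr => t _; rewrite mulrA -rmorphM -mulrBl -rmorphB.
case: eqVneq => [->|_] /=.
  by rewrite mulrCA mulVr // mulr1 subrr rmorph0 mul0r.
by congr (_%:D * _); ring.
Qed.
End Words.

(** * The subring Ubar[c_1, ..., c_n] and the center *)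

Section Center.
Variables (K : fieldType) (n : nat) (sigma : Ubar K n) (rho : {poly Ubar K n}).
Hypothesis S : solves sigma rho.
Local Notation Ub := (Ubar K n).
Local Notation h := (@hvar K n).
Local Notation hd := (@hdiff K n).
Local Notation D := (Diff sigma).
Local Notation R := {mpoly Ub[n]}.
Local Notation "p %:D" :=
  (ofUbar sigma p) (at level 2, left associativity, format "p %:D").
Local Notation x := (xgen sigma).
Local Notation d := (dgen sigma).
Local Notation Gam := (@Gamma K n sigma).
Local Notation c := (ccoef sigma rho).
Implicit Types (i j k l : 'I_n) (a b : int) (p q : Ub) (f : R) (z : D).

Let nz := Diff_neq0 S.

Definition ceval (P : R) : D :=
  mmap (ofUbarNz nz) (fun k => ccoef sigma rho k : DiffNz nz) P.

Lemma ceval_zmod : zmod_morphism ceval.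
Proof. by move=> P Q; rewrite /ceval mmapB. Qed.
HB.instance Definition _ := GRing.isZmodMorphism.Build R D ceval ceval_zmod.

Lemma central_prod_exp (m : 'X_{1..n}) :
  central (mmap1 (fun k => c k : DiffNz nz) m : D).
Proof.
move=> y; rewrite /mmap1; elim/big_rec: _ => [|i z _ IH].
  by rewrite mul1r mulr1.
have H : central ((c i) ^+ m i : D).
  move=> t; elim: (m i) => [|e IHe]; first by rewrite !expr0 mul1r mulr1.
  rewrite !exprS -mulrA IHe !mulrA; congr (_ * _); exact: central_solves.
by rewrite -[LHS](mulrA (c i ^+ m i : D)) IH mulrA H mulrA.
Qed.

(** The coefficients are not central in the target, but the c_k are, and this suffices for
    evaluation to be multiplicative. *)
Lemma ceval_monoid : monoid_morphism ceval.
Proof.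
have [||M M1] := @commr_mmap_is_multiplicative _ _ _
    (fun k => c k : DiffNz nz) (ofUbarNz nz).
- by move=> i z; exact/esym/(central_solves S).
- by move=> p m m'; exact/esym/central_prod_exp.
- by split; [exact: M1|exact: M].
Qed.
HB.instance Definition _ := GRing.isMonoidMorphism.Build R D ceval ceval_monoid.

Lemma cevalZ p f : ceval (p *: f) = p%:D * ceval f.
Proof. by rewrite /ceval mmapZ. Qed.

Lemma cevalC p : ceval p%:MP = p%:D.
Proof. by rewrite /ceval mmapC. Qed.

Lemma cevalX k : ceval 'X_k = c k.
Proof. by rewrite /ceval mmapX mmap1U. Qed.

Lemma cevalXm_central m : central (ceval 'X_[m]).
Proof. by rewrite /ceval mmapX; apply: central_prod_exp. Qed.

(** Taking f = 1 recovers P from its evaluation, whence the algebraic independence of the c_k over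
    Ubar. *)
Lemma dact_ceval P f : dact rho (ceval P) f = P * f.
Proof.
elim/mpolyind: P => [|u m P _ _ IH]; first by rewrite rmorph0 dact0 // mul0r.
rewrite rmorphD /= dactD // IH mulrDl cevalZ dactM // dactU //.
congr (_ + _); rewrite -scalerAl; congr (_ *: _).
rewrite /ceval mmapX mpolyXE_id /mmap1.
pose Q (z : D) (q : R) := forall f, dact rho z f = q * f.
apply: (big_ind2 Q) => [g|z q z' q' Hz Hz' g|i _].
- by rewrite dact1 // mul1r.
- by rewrite dactM // Hz' Hz mulrA.
- elim: (m i) => [|e IHe] g; first by rewrite expr0 dact1 // mul1r.
  by rewrite !exprS dactM // IHe dact_ccoef // mulrA.
Qed.

Lemma mshiftXm j a m : mshift j a 'X_[m] = 'X_[m] :> R.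
Proof.
rewrite mpolyXE_id rmorph_prod; apply: eq_bigr => i _.
by rewrite rmorphXn /= mshiftX.
Qed.

Lemma ceval_commute y j a : (forall p, p%:D * y = y * (shift j a p)%:D) ->
  forall P, ceval P * y = y * ceval (mshift j a P).
Proof.
move=> E; elim/mpolyind=> [|u m P _ _ IH];
  first by rewrite !rmorph0 mul0r mulr0.
rewrite !rmorphD /= mulrDl IH mulrDr mshiftZ !cevalZ mshiftXm; congr (_ + _).
by rewrite -mulrA cevalXm_central !mulrA E.
Qed.

Lemma ceval_x P j : ceval P * x j = x j * ceval (mshift j 1 P).
Proof. by apply: ceval_commute => p; apply: ofUbar_x. Qed.

Lemma ceval_d P j : ceval P * d j = d j * ceval (mshift j (-1) P).
Proof. by apply: ceval_commute => p; apply: ofUbar_d. Qed.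

Definition inA z := exists P, z = ceval P.

Lemma inAU p : inA p%:D. Proof. by exists p%:MP; rewrite cevalC. Qed.
Lemma inA1 : inA 1. Proof. by exists 1; rewrite rmorph1. Qed.
Lemma inAD z z' : inA z -> inA z' -> inA (z + z').
Proof. by case=> P -> [Q ->]; exists (P + Q); rewrite rmorphD. Qed.
Lemma inAN z : inA z -> inA (- z).
Proof. by case=> P ->; exists (- P); rewrite rmorphN. Qed.
Lemma inAM z z' : inA z -> inA z' -> inA (z * z').
Proof. by case=> P -> [Q ->]; exists (P * Q); rewrite rmorphM. Qed.
Lemma inA0 : inA 0. Proof. by exists 0; rewrite rmorph0. Qed.
Lemma inA_sum (I : Type) (r : seq I) (P : pred I) (F : I -> D) :
  (forall t, P t -> inA (F t)) -> inA (\sum_(i <- r | P i) F i).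
Proof. by move=> H; apply: big_ind => //; [exact: inA0|exact: inAD]. Qed.

(** Interpolation solves the equations defining the c_k for Gamma_i. *)
Lemma inA_Gamma i : inA (Gam i).
Proof.
have -> : Gam i = \sum_(k < n) (lagrange K i k)%:D * (c k + (rho`_k)%:D).
  rewrite (eq_bigr (fun k : 'I_n =>
    \sum_(j < n) (lagrange K i k * (equo K j)`_k)%:D * Gam j)).
    rewrite exchange_big (bigD1 i) //= -mulr_suml -rmorph_sum lagrangeK eqxx
      rmorph1 mul1r.
    rewrite big1 ?addr0 // => j ji.
    by rewrite -mulr_suml -rmorph_sum lagrangeK eq_sym (negbTE ji) rmorph0
      mul0r.
  move=> k _; rewrite subrK mulr_sumr; apply: eq_bigr => j _.
  by rewrite (rmorphM _ (lagrange K i k)) mulrA.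
apply: inA_sum => k _; apply: inAM; first exact: inAU.
by apply: inAD; [exists 'X_k; rewrite cevalX|exact: inAU].
Qed.

Lemma inA_xd i : inA (x i * d i).
Proof.
rewrite xd_eq; apply: inAD; last exact/inAN/inAU.
by apply: inA_sum => j _; apply: inAM; [exact: inAU|exact: inA_Gamma].
Qed.

Lemma x_inA j z : inA z -> exists2 z', inA z' & x j * z = z' * x j.
Proof.
by case=> P ->; exists (ceval (mshift j (-1) P));
  [exists (mshift j (-1) P)|rewrite ceval_x mshiftNK].
Qed.

Lemma d_inA j z : inA z -> exists2 z', inA z' & d j * z = z' * d j.
Proof.
by case=> P ->; exists (ceval (mshift j 1 P));
  [exists (mshift j 1 P)|rewrite ceval_d mshiftK].
Qed.

(** A new letter either extends the power or meets an opposite letter, and both x^i d_i and d_i x^i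
    lie in the subring. Elements of the subring move left through letters. *)
Lemma single_index i (w : seq ('I_n * bool)) : all (fun g => g.1 == i) w ->
  exists2 z, inA z & exists m : nat,
    (wprod sigma w = z * x i ^+ m /\ weight w i = m%:Z) \/
    (wprod sigma w = z * d i ^+ m /\ weight w i = - m%:Z).
Proof.
elim: w => [|[k b] w IH].
  move=> _; exists 1; first exact: inA1.
  by exists 0%N; left; rewrite wprod_nil weight_nil expr0 mulr1.
case/andP => /eqP ki /IH [z Az [m H]].
rewrite wprod_cons weight_cons ki eqxx /gen /sgn; move: ki => /= ->.
case: b H => [] [[-> ->]|[-> ->]].
- have [z' Az' E] := x_inA i Az; exists z' => //; exists m.+1; left.
  by rewrite mulrA E -mulrA -exprS.
(* With m = 0 there is no d_i to absorb the new x^i, and the result switches to the first power of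
   x^i. *)
- have [z' Az' E] := x_inA i Az; case: m => [|m].
    exists z' => //; exists 1%N; left.
    by rewrite mulrA E expr0 mulr1 expr1.
  exists (z' * (x i * d i)); first exact: inAM Az' (inA_xd i).
  exists m; right; split; first by rewrite mulrA E exprS !mulrA.
  by rewrite -addn1 PoszD; ring.
- have [z' Az' E] := d_inA i Az; case: m => [|m].
    exists z' => //; exists 1%N; right.
    by rewrite mulrA E expr0 mulr1 expr1.
  exists (z' * Gam i); first exact: inAM Az' (inA_Gamma i).
  exists m; left; split; first by rewrite mulrA E exprS /Gamma !mulrA.
  by rewrite -addn1 PoszD; ring.
- have [z' Az' E] := d_inA i Az; exists z' => //; exists m.+1; right.
  split; first by rewrite mulrA E -mulrA -exprS.
  by rewrite -addn1 PoszD; ring.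
Qed.

(** Gather the letters with the index i of the first letter. That block has weight zero, so its
    exponent in [single_index] is 0; the remaining word is shorter and still has zero weights. *)
Lemma weight0_inA (w : seq ('I_n * bool)) : (forall i, weight w i =
  0) -> inA (wprod sigma w).
Proof.
have [N] := ubnP (size w); elim: N w => // N IH [|[i b] w] sw w0.
  by rewrite wprod_nil; exact: inA1.
set v := (i, b) :: w in sw w0 *.
have [u ->] := wprod_filter sigma i v.
pose vi := [seq g <- v | g.1 == i]; pose v' := [seq g <- v | g.1 != i].
have H1 : inA (wprod sigma vi).
  have [|z Az [m H]] := @single_index i vi; first exact: filter_all.
  have E : weight vi i = 0 by rewrite weight_filter.
  suff E0 : m = 0%N by case: H => [] [-> _]; rewrite E0 expr0 mulr1.
  by case: H => [] [_]; rewrite E; [case|move=> /eqP;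
    rewrite eq_sym oppr_eq0 => /eqP[]].
have H2 : inA (wprod sigma v').
  apply: IH => [|j].
    apply: leq_trans (_ : size v <= N)%N; last by [].
    by rewrite /v' /v /= eqxx /= ltnS size_filter count_size.
  have [->|ji] := eqVneq j i; rewrite weight_filterC ?eqxx //.
  by rewrite ji.
by rewrite -mulrA; apply: inAM; [exact: inAU|exact: inAM].
Qed.

Hypothesis hK : [pchar K] =i pred0.

Lemma central_inA z : central z -> inA z.
Proof.
move=> zc; have [s sE] := word_span z.
have [|s' s'0 ->] := weight0_part hK sE; first by move=> i; rewrite zc.
rewrite big_seq; apply: inA_sum => t ts; apply: inAM; first exact: inAU.
by apply: weight0_inA; exact: s'0.
Qed.

(** Compare the actions of P x^j and x^j P on 1, then cancel the shifted gauge factor, a unit. *)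
Lemma inA_central_shift P j : central (ceval P) -> mshift j (-1) P = P.
Proof.
move=> Pc; have := congr1 (fun z => dact rho z 1) (Pc (x j)).
rewrite !dactM // dact_ceval !dact_x // dact_ceval mulr1 !mshiftZ rmorph1
  -scalerAr mulr1.
have ug : shift j (-1) (gauge K j) \is a GRing.unit.
  exact: (rmorph_unit (@shift K n j (-1)) (gauge_unit K j)).
by move=> /esym/(congr1 ( *:%R (shift j (-1) (gauge K j))^-1));
  rewrite !scalerA mulVr // !scale1r.
Qed.

Definition cpoly (p : {mpoly K[n]}) : D := ceval (map_mpoly (@cst K n) p).

Lemma cpoly_zmod : zmod_morphism cpoly.
Proof. by move=> p q; rewrite /cpoly !rmorphB. Qed.
Lemma cpoly_monoid : monoid_morphism cpoly.
Proof. by split=> [|p q]; rewrite /cpoly ?rmorph1 ?rmorphM. Qed.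
HB.instance Definition _ :=
  GRing.isZmodMorphism.Build {mpoly K[n]} D cpoly cpoly_zmod.
HB.instance Definition _ :=
  GRing.isMonoidMorphism.Build {mpoly K[n]} D cpoly cpoly_monoid.

Lemma cpolyC u : cpoly u%:MP = (cst n u)%:D.
Proof. by rewrite /cpoly map_mpolyC cevalC. Qed.

Lemma cpolyX k : cpoly 'X_k = c k.
Proof. by rewrite /cpoly map_mpolyX cevalX. Qed.

Lemma dact_cpoly (p : {mpoly K[n]}) f : dact rho (cpoly p) f =
  map_mpoly (@cst K n) p * f.
Proof. exact: dact_ceval. Qed.

Lemma mcoeff_cst (p : {mpoly K[n]}) m : (map_mpoly (@cst K n) p)@_m =
  cst n p@_m.
Proof. exact: mcoeff_map_mpoly. Qed.

Lemma cpoly_inj : injective cpoly.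
Proof.
move=> p q E; have {}E : map_mpoly (@cst K n) p = map_mpoly (@cst K n) q.
  apply: etrans (esym (etrans (dact_cpoly p 1) (mulr1 _))) _.
  by apply: etrans (congr1 (fun z => dact rho z 1) E) _;
    rewrite dact_cpoly mulr1.
apply/mpolyP => m.
have : cst n p@_m = cst n q@_m by rewrite -mcoeff_cst E mcoeff_cst.
by move=> /toUbar_inj /eqP; rewrite mpolyC_eq => /eqP.
Qed.

Lemma central_cst u : central (cst n u)%:D.
Proof.
apply: Diff_ind => [p|j|j|y Ey|y z Ey Ez|y z Ey Ez].
- by rewrite -!rmorphM mulrC.
- by rewrite ofUbar_x shift_cst.
- by rewrite ofUbar_d shift_cst.
- by rewrite mulrN mulNr Ey.
- by rewrite mulrDl mulrDr Ey Ez.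
- by rewrite (mulrA _ y) Ey -(mulrA y) Ez (mulrA y).
Qed.

Lemma cpoly_central (p : {mpoly K[n]}) : central (cpoly p).
Proof.
elim/mpolyind: p => [|u m p _ _ IH] y; first by rewrite rmorph0 mul0r mulr0.
rewrite rmorphD /= mulrDl mulrDr; congr (_ + _); last exact: IH.
have -> : cpoly (u *: 'X_[m]) = (cst n u)%:D * ceval 'X_[m].
  by rewrite -cevalZ /cpoly map_mpolyZ map_mpolyX.
by rewrite -mulrA cevalXm_central !mulrA central_cst.
Qed.

Lemma centralP z : central z <-> exists p : {mpoly K[n]}, cpoly p = z.
Proof.
split=> [zc|[p <-]]; last exact: cpoly_central.
have [P zE] := central_inA zc; rewrite zE in zc *.
have /choice [u uE] m : exists y, P@_m = cst n y.
  apply: (shift_invariant hK) => j.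
  by have := congr1 (mcoeff m) (inA_central_shift j zc); rewrite mcoeff_mshift.
exists (\sum_(m <- msupp P) u m *: 'X_[m]); rewrite /cpoly; congr ceval.
rewrite rmorph_sum [RHS]mpolyE; apply: eq_bigr => m _ /=.
by rewrite map_mpolyZ map_mpolyX /= uE.
Qed.

End Center.

(** Non-annihilation of x^j relies on an action, which requires a solution of the system. Since rho
    is not yet known to be one, the action is built from another solution rho0, available because
    sigma lies in W. *)
Lemma solves_central (K : fieldType) (n : nat) (sigma : Ubar K n) (rho : {poly
  Ubar K n}) :
  inW sigma -> (size rho <= n)%N ->
  (forall k : 'I_n, central (ccoef sigma rho k)) -> solves sigma rho.
Proof.
move=> sW srho rc j; have [rho0 [_ S0]] := solves_exists sW.
apply/polyP => m; rewrite /Deltat coefB coef_map coefZ /=.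
(* Centrality only concerns coefficients of index below n; beyond that both sides vanish by the
   degree bounds. *)
have [mn|nm] := ltnP m n; last first.
  by rewrite !nth_default ?rmorph0 ?subr0 ?mulr0 // ?(leq_trans _ nm) //
    size_equo.
have := ccoef_x sigma rho (Ordinal mn) j; rewrite rc subrr => /esym.
by move=> /(ofUbar_x_eq0 S0)/eqP; rewrite subr_eq0 => /eqP ->.
Qed.

Unset Implicit Arguments.

Theorem proposition3p8 (K : fieldType) (hK : [pchar K] =i pred0)
    (n : nat) (hn : (1 <= n)%N) (sigma : Ubar K n) (hsigma : inW sigma) :
  (* (i) *)
  (forall rho : {poly Ubar K n}, (size rho <= n)%N ->
     ((forall k : 'I_n, central (ccoef sigma rho k)) <-> solves sigma rho))
  /\
  (* (ii) *)
  [/\ forall s : Ubar K n, inW s ->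
        exists rho : {poly Ubar K n}, (size rho <= n)%N /\ solves s rho,
      forall (k : 'I_n) (A : {poly K}) (rho : {poly Ubar K n}),
        (size rho <= n)%N ->
        (solves (Wfrac k A) rho <->
         exists kappa : {poly K}, (size kappa <= n)%N /\
           rho = Wfrac k A *: equo K k + map_poly (@cst K n) kappa)
    & forall A : 'I_n -> {poly K},
        solves (\sum_(k < n) Wfrac k (A k))
               (\sum_(k < n) Wfrac k (A k) *: equo K k)]
  /\
  (* (iii) *)
  (forall rho : {poly Ubar K n}, (size rho <= n)%N -> solves sigma rho ->
     exists phi : {rmorphism {mpoly K[n]} -> Diff sigma},
       [/\ forall a : K, phi a%:MP = ofUbar sigma (cst n a),
           forall j : 'I_n, phi 'X_j = ccoef sigma rho j,
           injective phi
         & forall z : Diff sigma, central z <-> exists p, phi p = z]).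
Proof.
split; [|split; [split|]].
- move=> rho srho; split=> [|S k]; first exact: solves_central.
  exact: central_solves.
- exact: solves_exists.
- move=> k A rho srho; apply: solves_unique => //; last exact: solves_Wfrac.
  by apply: (leq_trans (size_scale_leq _ _)); apply: size_equo.
- exact: solves_sum_Wfrac.
move=> rho _ S; exists (cpoly S); split.
- exact: cpolyC.
- exact: cpolyX.
- exact: cpoly_inj.
- exact: centralP.
Qed.
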